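(* Let $n\ge 1$ be an integer. The poset $P^B_n$ of $(21,\overline{2}\,\overline{1})$-avoiding elements of the hyperoctahedral group $B_n$, ordered by containment of the descent set, is an extension of the refinement order on the type-B noncrossing partition lattice $NC^B_n$; that is, there is a bijection $\varphi\colon NC^B_n\to P^B_n$ such that $\pi<\pi'$ in $NC^B_n$ implies $\varphi(\pi)<\varphi(\pi')$ in $P^B_n$. The poset $P^B_n$ has the same rank generating function as $NC^B_n$, therefore it is rank-symmetric and rank-unimodal, and it is a self-dual and strongly Sperner poset.
   Context: Let $[n]=\{1,\dots,n\}$. Type-B noncrossing partitions. Consider the set $\{1,2,\dots,n,\overline{1},\overline{2},\dots,\overline{n}\}$ with the involution $a\mapsto\overline{a}$ (so $\overline{\overline{a}}=a$). A type-B partition of $[n]$ is a set partition of this set such that (i) if $\{a_1,\dots,a_k\}$ is a block then $\{\overline{a_1},\dots,\overline{a_k}\}$ is also a block, and (ii) there is at most one block invariant under the bar operation (the zero-block, if present). Place $1,2,\dots,n,\overline{1},\overline{2},\dots,\overline{n}$ clockwise in this order around a circle. A type-B partition is noncrossing if there are no four elements $a,b,c,d$ in clockwise order around the circle with $a,c$ in one block and $b,d$ in another block. $NC^B_n$ is the set of type-B noncrossing partitions of $[n]$ ordered by refinement ($\pi\le\pi'$ if each block of $\pi'$ is a union of blocks of $\pi$). It is ranked by $\mathrm{rk}(\pi)=n-\#\{\text{pairs } \{\beta,\overline{\beta}\} \text{ of non-zero blocks of } \pi\}$. Signed permutations. Elements of $B_n$ are words $b=b_1b_2\cdots b_n$ in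 which each of $1,\dots,n$ appears exactly once, barred or unbarred; $|b_i|\in[n]$ is the symbol $b_i$ with any bar removed. The signed permutation $b$ is $(21,\overline{2}\,\overline{1})$-avoiding if there are no indices $1\le i<j\le n$ such that $b_i,b_j$ are both barred or both unbarred and $|b_i|>|b_j|$. With respect to the total order $1<2<\cdots<n<\overline{n}<\cdots<\overline{2}<\overline{1}$, $b$ has a descent at $i$ (for $1\le i\le n-1$) if $b_i>b_{i+1}$, and it has a descent at $n$ if $b_n$ is barred; $\mathrm{Des}(b)\subseteq[n]$ is the set of descents. $P^B_n$ is the set of $(21,\overline{2}\,\overline{1})$-avoiding elements of $B_n$, with strict order $b<b'$ if and only if $\mathrm{Des}(b)\subsetneq\mathrm{Des}(b')$ (distinct elements with equal descent set are incomparable). It is ranked by $\mathrm{rk}(b)=\#\mathrm{Des}(b)$. For a finite ranked poset whose ranks run over $0,1,\dots,r$, with $w_k$ elements of rank $k$: the rank generating function is $\sum_{k=0}^r w_kx^k$; the poset is rank-symmetric if $w_k=w_{r-k}$ for all $k$; rank-unimodal if $w_0\le\cdots\le w_j\ge\cdots\ge w_r$ for some $j$; strongly Sperner if for every $k\ge1$ the maximum cardinality of a union of $k$ antichains equals the sum of the $k$ largest rank sizes. A poset is self-dual if it is isomorphic to its order dual. *)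

(* Defs.v *)
From HB Require Import structures.
From mathcomp Require Import all_boot all_order all_algebra.

Set Implicit Arguments.
Unset Strict Implicit.
Unset Printing Implicit Defensive.

Import Order.TTheory.
Local Open Scope nat_scope.

(* The pair (i, false) is the symbol i+1 and (i, true) the symbol i+1 with a
   bar. *)
Notation letter n := ('I_n * bool)%type.

Definition barred n (x : letter n) : bool := x.2.

Definition bar n (x : letter n) : letter n := (x.1, ~~ x.2).

Definition bar_block n (B : {set letter n}) : {set letter n} :=
  [set bar x | x in B].

(* The place of x in the clockwise sequence 1, ..., n, bar 1, ..., bar n. *)
Definition place n (x : letter n) : nat := if barred x then n + x.1 else x.1.

(* Clockwise order is cyclic, so the places increase only up to a rotation. *)
Definition clockwise n (s : seq (letter n)) : bool :=
  has (fun k => sorted ltn (rot k (map (@place n) s))) (iota 0 (size s)).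

Definition typeB_partition n (pi : {set {set letter n}}) : bool :=
  [&& partition pi [set: letter n],
      [forall B in pi, bar_block B \in pi]
    & #|[set B in pi | bar_block B == B]| <= 1].

Definition noncrossing n (pi : {set {set letter n}}) : bool :=
  [forall B in pi, forall B' in pi, (B != B') ==>
    [forall a, forall b, forall c, forall d,
      clockwise [:: a; b; c; d] ==>
      ~~ [&& a \in B, c \in B, b \in B' & d \in B']]].

Record NCB (n : nat) := MkNCB {
  ncb_val :> {set {set letter n}};
  _ : typeB_partition ncb_val && noncrossing ncb_val }.

HB.instance Definition _ n := [isSub for @ncb_val n].
HB.instance Definition _ n := [Finite of NCB n by <:].

Definition refines (T : finType) (pi pi' : {set {set T}}) : bool :=
  [forall B in pi', exists S : {set {set T}}, (S \subset pi) && (cover S == B)].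

Lemma refines_refl (T : finType) : reflexive (@refines T).
Proof.
move=> pi; apply/forall_inP => B piB; apply/existsP; exists [set B].
by rewrite sub1set piB /cover big_set1 eqxx.
Qed.

Lemma refines_trans (T : finType) : transitive (@refines T).
Proof.
move=> pi2 pi1 pi3 /forall_inP r12 /forall_inP r23.
apply/forall_inP => B /r23 /existsP[S /andP[/subsetP sS /eqP <-]].
apply/existsP; exists [set A in pi1 | A \subset cover S]; apply/andP; split.
  by apply/subsetP => A; rewrite inE => /andP[].
rewrite eqEsubset; apply/andP; split; apply/subsetP => x /bigcupP[A].
  by rewrite inE => /andP[_ /subsetP sA] /sA.
move=> SA xA; have /existsP[U /andP[/subsetP sU /eqP dA]] := r12 _ (sS _ SA).
move: xA; rewrite -dA => /bigcupP[C UC xC]; apply/bigcupP; exists C => //.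
rewrite inE sU //=; apply/subsetP => y yC; apply/bigcupP; exists A => //.
by rewrite -dA; apply/bigcupP; exists C.
Qed.

Lemma refines_sub (T : finType) (pi pi' : {set {set T}}) :
  partition pi' [set: T] -> refines pi pi' -> refines pi' pi ->
  pi' \subset pi.
Proof.
move=> /and3P[_ /trivIsetP tI n0] /forall_inP r /forall_inP r'.
apply/subsetP => B B_pi'.
have /set0Pn[x xB] : B != set0 by apply: contraNneq n0 => <-.
have /existsP[S /andP[/subsetP sS /eqP dB]] := r _ B_pi'.
have /bigcupP[A SA xA] : x \in cover S by rewrite dB.
have /existsP[U /andP[/subsetP sU /eqP dA]] := r' _ (sS _ SA).
have /bigcupP[C UC xC] : x \in cover U by rewrite dA.
have eqCB : C = B.
  apply/eqP; apply: contraT => neqCB.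
  have := tI _ _ (sU _ UC) B_pi' neqCB.
  by rewrite disjoint_subset => /subsetP/(_ _ xC); rewrite inE xB.
suff -> : B = A by exact: sS.
apply/eqP; rewrite eqEsubset -{1}eqCB -{1}dA -dB.
by rewrite /cover (bigcup_sup C) // (bigcup_sup A).
Qed.

Definition ncb_le n (pi pi' : NCB n) : bool := refines pi pi'.

Lemma ncb_le_refl n : reflexive (@ncb_le n).
Proof. by move=> pi; apply: refines_refl. Qed.

Lemma ncb_le_anti n : antisymmetric (@ncb_le n).
Proof.
move=> pi pi' /andP[r r']; apply: val_inj; apply/eqP; rewrite eqEsubset.
have p (x : NCB n) : partition (val x) [set: letter n].
  by case: x => x /= /andP[/and3P[]].
by apply/andP; split; apply: refines_sub.
Qed.

Lemma ncb_le_trans n : transitive (@ncb_le n).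
Proof. by move=> ? ? ?; apply: refines_trans. Qed.

Fact ncb_display : Order.disp_t. Proof. exact: Order.Disp tt tt. Qed.

HB.instance Definition _ n := Order.Le_isPOrder.Build ncb_display (NCB n)
  (@ncb_le_refl n) (@ncb_le_anti n) (@ncb_le_trans n).

(* There are at most n pairs of non-zero blocks: the subtraction does not
   truncate. *)
Definition ncb_rank n (pi : NCB n) : nat :=
  n - #|[set [set B; bar_block B] | B in ncb_val pi & bar_block B != B]|.

Definition signed_perm n (b : n.-tuple (letter n)) : bool :=
  [forall k : 'I_n, count_mem k [seq x.1 | x <- b] == 1].

Definition avoiding n (b : n.-tuple (letter n)) : bool :=
  ~~ [exists i : 'I_n, exists j : 'I_n,
       [&& i < j, barred (tnth b i) == barred (tnth b j)
         & (tnth b j).1 < (tnth b i).1]].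

(* The place of x in the chain 1 < ... < n < bar n < ... < bar 1. *)
Definition key n (x : letter n) : nat :=
  if barred x then n.*2.-1 - x.1 else x.1.

(* The position i : 'I_n stands for i+1, so position n is the i with
   i.+1 = n; it is a descent exactly when its letter is barred. *)
Definition Des n (b : n.-tuple (letter n)) : {set 'I_n} :=
  [set i : 'I_n |
    [exists j : 'I_n, (j == i.+1 :> nat) && (key (tnth b j) < key (tnth b i))]
    || ((i.+1 == n) && barred (tnth b i))].

Record PB (n : nat) := MkPB {
  pb_val :> n.-tuple (letter n);
  _ : signed_perm pb_val && avoiding pb_val }.

HB.instance Definition _ n := [isSub for @pb_val n].
HB.instance Definition _ n := [Finite of PB n by <:].

Definition pb_lt n (b b' : PB n) : bool := Des b \proper Des b'.

Lemma pb_lt_irr n : irreflexive (@pb_lt n).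
Proof. by move=> b; rewrite /pb_lt properxx. Qed.

Lemma pb_lt_trans n : transitive (@pb_lt n).
Proof. by move=> b2 b1 b3; apply: proper_trans. Qed.

Fact pb_display : Order.disp_t. Proof. exact: Order.Disp tt tt. Qed.

HB.instance Definition _ n := Order.Lt_isPOrder.Build pb_display (PB n)
  (@pb_lt_irr n) (@pb_lt_trans n).

Definition pb_rank n (b : PB n) : nat := #|Des b|.

(* The ranks of a ranked poset with rank function rk run over
   0, ..., top_rank rk. *)
Definition top_rank (T : finType) (rk : T -> nat) : nat := \max_(x : T) rk x.

Definition rank_size (T : finType) (rk : T -> nat) (k : nat) : nat :=
  #|[set x | rk x == k]|.

Definition rank_gf (T : finType) (rk : T -> nat) : {poly int} :=
  (\sum_(k < (top_rank rk).+1) (rank_size rk k)%:Z *: 'X^k)%R.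

Definition rank_symmetric (T : finType) (rk : T -> nat) : Prop :=
  forall k, k <= top_rank rk ->
    rank_size rk k = rank_size rk (top_rank rk - k).

Definition rank_unimodal (T : finType) (rk : T -> nat) : Prop :=
  exists j, [/\ j <= top_rank rk,
    forall k, k < j -> rank_size rk k <= rank_size rk k.+1 &
    forall k, j <= k -> k < top_rank rk ->
      rank_size rk k.+1 <= rank_size rk k].

Definition antichain d (T : finPOrderType d) (A : {set T}) : bool :=
  [forall x in A, forall y in A, ~~ (x < y)%O].

(* The antichains of the family may coincide or be empty, which does not
   affect the maximum. *)
Definition max_antichain_union d (T : finPOrderType d) (k : nat) : nat :=
  \max_(F : {ffun 'I_k -> {set T}} | [forall i, antichain (F i)])
    #|\bigcup_(i < k) F i|.

(* When k exceeds the number of ranks this is the sum of all rank sizes. *)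
Definition sum_largest_ranks (T : finType) (rk : T -> nat) (k : nat) : nat :=
  sumn (take k (sort geq (mkseq (rank_size rk) (top_rank rk).+1))).

Definition strongly_sperner d (T : finPOrderType d) (rk : T -> nat) : Prop :=
  forall k, 1 <= k -> max_antichain_union T k = sum_largest_ranks rk k.

Definition self_dual d (T : porderType d) : Prop :=
  exists f : T -> T^d, bijective f /\ {mono f : x y / (x <= y)%O}.

(* Main.v *)
Require Import Defs.
From mathcomp Require Import all_boot all_order all_algebra.
From mathcomp Require Import fingroup perm zify.

(* Call a point of the circle an opener if none of the n points preceding it
   lies in its block, and a closer if none of the n points following it does.
   Forgetting bars, a noncrossing type-B partition pi yields two subsets O, C of
   [n] with |O| = |C|.  Conversely, from such a pair one builds a periodic walk
   that steps up just before each opener and down just after each closer; two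
   points lie in one block when the walk has the same height at both and does
   not go below that height in between.  So pi |-> (O, C) is a bijection, and
   |O| is the number of pairs of non-zero blocks.  Merging blocks can only
   destroy openers and closers, so pi < pi' makes O strictly smaller.

   In a (21, bar 2 bar 1)-avoiding signed permutation b the descents are exactly
   the barred positions, and b is determined by its set of barred positions and
   its set of barred symbols, which are arbitrary of equal size.  Matching these
   two sets with the complements of O and C gives the order extension, the rank
   sizes 'C(n, k) ^ 2 and the self-duality.  The strong Sperner property is a
   LYM argument: pairs of permutations move a maximal chain so that all elements
   of one rank are met equally often, while a chain meets a union of k antichains
   in at most k elements, whose ranks are distinct. *)

Set Implicit Arguments.
Unset Strict Implicit.
Unset Printing Implicit Defensive.

Import Order.TTheory.
Local Open Scope nat_scope.

(** * Counting on intervals and periodic predicates *)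

Lemma card_ord_pred (n : nat) (P : pred nat) :
  #|[set i : 'I_n | P i]| = count P (iota 0 n).
Proof. by rewrite cardsE cardE size_filter -val_enum_ord count_map enumT. Qed.

Lemma periodic_mod (T : Type) (n : nat) (f : nat -> T) :
  (forall i, f (i + n) = f i) -> forall i, f (i %% n) = f i.
Proof.
move=> fn i; rewrite {2}(divn_eq i n) addnC.
by elim: (i %/ n) => [|q IHq]; rewrite ?addn0 // mulSn addnCA addnC fn.
Qed.

Lemma count_period (n : nat) (P : pred nat) :
  (forall i, P (i + n) = P i) ->
  forall k, count P (iota k n) = count P (iota 0 n).
Proof.
move=> Pn; elim=> // k <-; case: n Pn => [//|n] Pn.
by rewrite -{1}[n.+1]addn1 iotaD count_cat /= -(Pn k) addn0 addnC addSnnS.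
Qed.

(** Sending each [x] to the first related [y] of [t] is injective; a relation as input spares the
    construction of that map at every use. *)
Lemma leq_count_rel (P Q : pred nat) (r : rel nat) (s t : seq nat) :
  uniq s ->
  {in s, forall x, P x -> exists2 y, y \in t & Q y && r x y} ->
  (forall x x' y, x \in s -> x' \in s -> P x -> P x' -> r x y -> r x' y ->
     x = x') ->
  count P s <= count Q t.
Proof.
move=> us ex inj.
pose f x := nth 0 t (find (fun y => Q y && r x y) t).
have fP x : x \in s -> P x -> [&& f x \in t, Q (f x) & r x (f x)].
  move=> xs Px; have [y yt Qy] := ex x xs Px.
  have hasf : has (fun y => Q y && r x y) t by apply/hasP; exists y.
  by rewrite mem_nth -?has_find //=; apply: (nth_find 0 hasf).
rewrite -!size_filter -(size_map f); apply: uniq_leq_size.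
  rewrite map_inj_in_uniq ?filter_uniq // => x x'.
  rewrite !mem_filter => /andP[Px xs] /andP[Px' xs'] eqf.
  have /and3P[_ _ rx] := fP x xs Px; have /and3P[_ _ rx'] := fP x' xs' Px'.
  by apply: (inj x x' (f x)); rewrite // eqf.
move=> y /mapP[x xPs y_fx]; move: xPs; rewrite {}y_fx !mem_filter.
by case/andP=> Px xs; have /and3P[-> ->] := fP x xs Px.
Qed.

(** * Openers and closers of a relation on the circle *)

(* The circle is unrolled onto [nat] with period [2n], the bar acting as the
   translation by [n]; [E i j] says that the points at [i] and [j] lie in the
   same block. *)
Record bar_periodic (n : nat) (E : rel nat) : Prop := BarPeriodic {
  bp_refl : reflexive E;
  bp_sym : symmetric E;
  bp_trans : transitive E;
  bp_bar : forall i j, E (i + n) (j + n) = E i j;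
  bp_turn : forall i j, E i (j + n.*2) = E i j }.

Definition uncrossed (n : nat) (E : rel nat) : Prop :=
  forall a b c d, a < b -> b < c -> c < d -> d < a + n.*2 ->
    E a c -> E b d -> E a b.

(* In a noncrossing type-B partition a block and its image under the bar lie on
   disjoint arcs unless they coincide, so an opener is the clockwise first
   point of a non-zero block, and a closer is the last one. *)
Definition opener (n : nat) (E : rel nat) (i : nat) : bool :=
  all (fun j => ~~ E (i + n) j) (iota i n).

Definition closer (n : nat) (E : rel nat) (i : nat) : bool :=
  all (fun j => ~~ E i j) (iota i.+1 n).

Section Periodic.
Variables (n : nat) (E : rel nat).

Lemma openerP i :
  reflect (forall j, i <= j < i + n -> ~~ E (i + n) j) (opener n E i).
Proof.
apply: (iffP allP) => h j; first by move=> hj; apply: h; rewrite mem_iota.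
by rewrite mem_iota; apply: h.
Qed.

Lemma closerP i :
  reflect (forall j, i < j <= i + n -> ~~ E i j) (closer n E i).
Proof.
apply: (iffP allP) => h j; last by rewrite mem_iota addSn ltnS; apply: h.
by move=> hj; apply: h; rewrite mem_iota addSn ltnS.
Qed.

Hypothesis bpE : bar_periodic n E.

Let Erefl := bp_refl bpE.
Let Esym := bp_sym bpE.
Let Etrans := bp_trans bpE.
Let Ebar := bp_bar bpE.
Let Eturn := bp_turn bpE.

Lemma bp_barC i j : E (i + n) j = E i (j + n).
Proof. by rewrite -(Ebar i) -addnA addnn Eturn. Qed.

Lemma opener_bar i : opener n E (i + n) = opener n E i.
Proof.
apply/openerP/openerP => h j hj.
  by rewrite -Ebar; apply: h; lia.
have -> : j = j - n + n by lia.
by rewrite Ebar; apply: h; lia.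
Qed.

Lemma closer_bar i : closer n E (i + n) = closer n E i.
Proof.
apply/closerP/closerP => h j hj.
  by rewrite -Ebar; apply: h; lia.
have -> : j = j - n + n by lia.
by rewrite Ebar; apply: h; lia.
Qed.

(** [opener] looks back from [i + n] so that nothing truncates; invariance under the bar lets it be
    read at [i] itself once [n <= i]. *)
Lemma opener_backP i : n <= i ->
  reflect (forall j, i - n <= j < i -> ~~ E i j) (opener n E i).
Proof.
by move=> le_ni; have := openerP (i - n); rewrite -opener_bar !subnK.
Qed.

Lemma closer_of_opener l : 0 < n -> opener n E l ->
  exists q, [/\ l <= q < l + n, E l q & closer n E q].
Proof.
move=> n_gt0 /openerP op_l.
have ex : exists q, (l <= q < l + n) && E l q by exists l; rewrite Erefl; lia.
have bnd q : (l <= q < l + n) && E l q -> q <= l + n by lia.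
case: (ex_maxnP ex bnd) => q /andP[lq Elq] maxq.
exists q; split => //; apply/closerP => z hz; apply/negP => Eqz.
have Elz := Etrans Elq Eqz.
have [lt_z | ge_z] := ltnP z (l + n).
  by have := maxq z; rewrite Elz; lia.
have /op_l : l <= z - n < l + n by lia.
by rewrite bp_barC subnK ?Elz //; lia.
Qed.

(** The mirror argument, with the first mate of [q] after [q - n]; [n.*2 <= q] keeps [l - n] from
    truncating. *)
Lemma opener_of_closer q : 0 < n -> n.*2 <= q -> closer n E q ->
  exists l, [/\ q < l + n, l <= q, E q l & opener n E l].
Proof.
move=> n_gt0 le_nq /closerP cl_q.
have ex : exists l, (q < l + n) && (l <= q) && E q l.
  by exists q; rewrite Erefl; lia.
case: (ex_minnP ex) => l /andP[/andP[lt_q le_q] Eql] minl.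
exists l; split => //; apply/opener_backP => [|z hz]; first by lia.
apply/negP => Elz; have Eqz := Etrans Eql Elz.
have [lt_z | ge_z] := ltnP q (z + n).
  by have := minl z; rewrite Eqz; lia.
have /cl_q : q < z + n.*2 <= q + n by lia.
by rewrite Eturn Eqz.
Qed.

(** Either [x] is among the [n] points before [y], or [y] is among the [n] points before
    [x + n.*2]. *)
Lemma openers_uniq x y :
  opener n E x -> opener n E y -> x < y < x + n.*2 -> ~~ E x y.
Proof.
move=> op_x op_y hxy; have [le_y | lt_y] := leqP y (x + n).
  move: op_y; rewrite -opener_bar => /opener_backP/(_ (x + n)).
  by rewrite leq_addl Ebar Esym => -> //; lia.
move/openerP: op_x => /(_ (y - n)); rewrite bp_barC subnK; last by lia.
by move=> -> //; lia.
Qed.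

Lemma closers_uniq x y :
  closer n E x -> closer n E y -> x < y < x + n.*2 -> ~~ E x y.
Proof.
move=> /closerP cl_x /closerP cl_y hxy; have [le_y | lt_y] := leqP y (x + n).
  by apply: cl_x; lia.
by rewrite Esym -Eturn; apply: cl_y; lia.
Qed.

Lemma mates_mod i j : E i j -> E i (j %% n) || E i (j %% n + n).
Proof.
pose f j := E i j || E i (j + n); move=> Eij.
have fn k : f (k + n) = f k by rewrite /f -addnA addnn Eturn orbC.
by have := periodic_mod fn j; rewrite /f Eij.
Qed.

Lemma circle_mates i j l :
  E i l || E i (l + n) -> E j l || E j (l + n) -> E i j || E i (j + n).
Proof.
have tr a b c : E a c -> E b c -> E a b.
  by move=> Eac; rewrite Esym; apply: Etrans.
case/orP=> Ei /orP[] Ej; apply/orP.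
- by left; apply: tr Ei Ej.
- by right; apply: tr Ei _; rewrite -Eturn -addnn addnA Ebar.
- by right; apply: tr Ei _; rewrite Ebar.
- by left; apply: tr Ei Ej.
Qed.

Lemma separated_mod (P : pred nat) : (forall i, P (i + n) = P i) ->
    (forall x y, P x -> P y -> x < y < x + n.*2 -> ~~ E x y) ->
  forall x y, x < n -> y < n -> P x -> P y -> E x y || E x (y + n) -> x = y.
Proof.
move=> Pn sepP x y; wlog lt_xy: x y / x < y => [IH|] ltx lty Px Py Exy.
  have [/IH-> // | /IH eq_yx | //] := ltngtP x y.
  by rewrite eq_yx // Esym -bp_barC (Esym _ x).
move: Exy.
rewrite (negbTE (sepP x y _ _ _)) ?(negbTE (sepP x (y + n) _ _ _)) //;
  rewrite ?Pn //; lia.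
Qed.

(** Match openers and closers that are mates up to the bar. Partners exist by [closer_of_opener] and
    [opener_of_closer], and [separated_mod] makes the matching injective both ways. *)
Lemma count_closers : 0 < n ->
  count (closer n E) (iota 0 n) = count (opener n E) (iota 0 n).
Proof.
move=> n_gt0; apply/eqP; rewrite eqn_leq; apply/andP; split;
  apply: (@leq_count_rel _ _ (fun i j => E i j || E i (j + n)));
  rewrite ?iota_uniq //.
- move=> q; rewrite mem_iota => lt_q.
  rewrite -2!closer_bar -addnA addnn => /opener_of_closer.
  case=> // [|l [_ _ Eql op_l]]; first by lia.
  exists (l %% n); first by rewrite mem_iota ltn_pmod.
  rewrite (periodic_mod opener_bar) op_l; apply: mates_mod.
  by rewrite Esym -Eturn Esym.
- move=> x y l; rewrite !mem_iota => ltx lty cl_x cl_y Ex Ey.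
  apply: (separated_mod closer_bar closers_uniq) => //.
  exact: circle_mates Ex Ey.
- move=> l _ /(closer_of_opener n_gt0)[q [_ Elq cl_q]].
  exists (q %% n); first by rewrite mem_iota ltn_pmod.
  by rewrite (periodic_mod closer_bar) cl_q; apply: mates_mod.
- move=> x y l; rewrite !mem_iota => ltx lty op_x op_y Ex Ey.
  apply: (separated_mod opener_bar openers_uniq) => //.
  exact: circle_mates Ex Ey.
Qed.

Section Uncrossed.
Hypothesis ncE : uncrossed n E.

(** Take for [l] the first mate of [x] after [x - n]. If it had a mate [z] in the preceding [n]
    points, then minimality gives [z + n <= x], and the equalities [z + n = x] and [z + n = l] make
    the block of [x] a zero-block. Otherwise [z < x - n < l < z + n], and the chords from [z] to [l]
    and from [x - n] to [z + n] cross, which again makes [x] a mate of its bar. *)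
Lemma opener_exists x : n.*2 <= x -> ~~ E x (x + n) ->
  exists2 l, E x l & opener n E l.
Proof.
move=> le_nx nz_x; have ex : exists l, (x < l + n) && (l <= x) && E x l.
  exists x; rewrite Erefl.
  by case: n nz_x => [|m _]; [rewrite addn0 Erefl | lia].
case: (ex_minnP ex) => l /andP[/andP[lt_x le_x] Exl] minl.
exists l => //; apply/opener_backP => [|z hz]; first by lia.
apply/negP => Elz; have Exz := Etrans Exl Elz.
have [lt_z | ge_z] := ltnP x (z + n).
  by have := minl z; rewrite Exz; lia.
have [eq_z | ne_z] := eqVneq x (z + n).
  by move: nz_x; rewrite {2}eq_z -addnA addnn Eturn Exz.
have [eq_l | ne_l] := eqVneq l (z + n).
  move: nz_x.
  rewrite (Etrans Exz) // (Etrans (_ : E z (z + n))) ?Ebar ?(Esym z) //.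
  by rewrite -eq_l.
have Ezx : E z (x - n).
  apply: (ncE (c := l) (d := z + n)); rewrite ?(Esym z) //; try lia.
  by rewrite -Ebar subnK; [rewrite -addnA addnn Eturn | lia].
move: Ezx; rewrite -Ebar bp_barC subnK; last by lia.
by move=> /(Etrans Exz) Exx; rewrite Exx in nz_x.
Qed.


(** The opener [l] of the block of [q] cannot be [a], a non-mate of [q]; if it came before [a], the
    chords from [l] to [q] and from [a] to [b] would cross. *)
Lemma opener_inside a b q : n.*2 <= a -> a < q < b -> b <= a + n -> E a b ->
    (forall z, a < z < b -> ~~ E a z) -> closer n E q ->
  exists l, [/\ a < l <= q, E q l & opener n E l].
Proof.
move=> le_na hq hb Eab gap cl_q.
have [||l [lt_q le_q Eql op_l]] := opener_of_closer _ _ cl_q; try lia.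
exists l; split => //; have nEaq := gap q hq; rewrite le_q andbT ltnNge.
apply: contra nEaq; rewrite leq_eqVlt => /predU1P[<- | lt_la].
  by rewrite Esym.
apply: (Etrans (y := l)); last by rewrite Esym.
rewrite Esym; apply: (ncE (c := q) (d := b)) => //; rewrite 1?Esym //; lia.
Qed.

Lemma closer_inside a b l : a < l < b -> b <= a + n -> E a b ->
    (forall z, a < z < b -> ~~ E a z) -> opener n E l ->
  exists q, [/\ l <= q < b, E l q & closer n E q].
Proof.
move=> hl hb Eab gap op_l.
have [|q [/andP[le_l lt_q] Elq cl_q]] := closer_of_opener _ op_l; first by lia.
exists q; split => //; have nEal := gap l hl; rewrite le_l ltnNge.
apply: contra nEal; rewrite leq_eqVlt => /predU1P[eq_b | lt_bq].
  by rewrite eq_b in Eab *; rewrite (Etrans Eab) // Esym.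
by apply: (ncE (c := b) (d := q)) => //; lia.
Qed.

End Uncrossed.

Lemma bp_mod i j : E (i %% n.*2) (j %% n.*2) = E i j.
Proof.
rewrite (periodic_mod (f := E _)) // Esym.
by rewrite (periodic_mod (f := E _)) // Esym.
Qed.

End Periodic.

(** Of two points of the circle, one follows the other within [n] steps, and mates at such a
    distance are joined by a string of consecutive mates. Adding a turn secures [n.*2 <= x]. *)
Lemma consecutive_mates_ind (n : nat) (E Q : rel nat) :
    0 < n -> bar_periodic n E -> bar_periodic n Q ->
    (forall x y, n.*2 <= x -> x < y -> y <= x + n -> E x y ->
       (forall z, x < z < y -> ~~ E x z) -> Q x y) ->
  subrel E Q.
Proof.
move=> n_gt0 bpE bpQ EQ.
have EQn d x y : n.*2 <= x -> x < y -> y <= x + n -> y - x <= d ->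
    E x y -> Q x y.
  elim: d x y => [|d IHd] x y le_nx lt_xy le_yn le_d Exy; first by lia.
  have [/hasP[z] | /hasPn gap] := boolP (has (E x) (iota x.+1 (y - x.+1))).
    rewrite mem_iota => hz Exz; apply: (bp_trans bpQ) (_ : Q z y).
      by apply: IHd => //; lia.
    by apply: IHd; rewrite ?(bp_trans bpE _ Exy) // 1?(bp_sym bpE) //; lia.
  by apply: EQ => // z hz; apply: gap; rewrite mem_iota; lia.
have turn2 (A : rel nat) : bar_periodic n A ->
    forall x y, A (x + n.*2) (y + n.*2) = A x y.
  by move=> bpA x y; rewrite -addnn !addnA !(bp_bar bpA).
suff EQlt x y : x < n.*2 -> y < n.*2 -> E x y -> Q x y.
  move=> x y; rewrite -(bp_mod bpE) -(bp_mod bpQ).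
  by apply: EQlt; rewrite ltn_pmod // double_gt0.
wlog lt_xy: x y / x < y => [IH|] ltx lty Exy.
  have [lt | lt | ->] := ltngtP x y; first exact: IH.
    by rewrite (bp_sym bpQ) IH // (bp_sym bpE).
  exact: bp_refl bpQ y.
have [le_n | gt_n] := leqP y (x + n).
  rewrite -turn2 //; apply: (EQn (y - x)); try lia.
  by rewrite turn2.
rewrite (bp_sym bpQ) -(bp_turn bpQ) -turn2 //.
apply: (EQn (x + n.*2 - y)); try lia.
by rewrite turn2 // (bp_turn bpE) (bp_sym bpE).
Qed.

(* If [x < y] are consecutive in a block of [E'], then [y] is not an opener and
   [x] not a closer, so [y] has an [E]-mate [z <= x] and [x] has an [E]-mate
   [w >= y]; as [E] is noncrossing these four points lie in one block of [E]. *)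
Lemma uncrossed_sub_eq (n : nat) (E E' : rel nat) :
    0 < n -> bar_periodic n E -> bar_periodic n E' -> uncrossed n E ->
    subrel E E' -> opener n E =1 opener n E' -> closer n E =1 closer n E' ->
  E =2 E'.
Proof.
move=> n_gt0 bpE bpE' ncE sEE' op_eq cl_eq x y.
apply/idP/idP; first exact: sEE'.
move: x y; apply: (consecutive_mates_ind n_gt0 bpE' bpE).
move=> x y le_nx lt_xy le_y E'xy gap.
have [z hz Eyz] : exists2 z, y - n <= z < y & E y z.
  have /allPn[z] : ~~ opener n E (y - n).
    rewrite op_eq; apply/openerP => /(_ x).
    rewrite subnK ?(bp_sym bpE' _ x) ?E'xy; last by lia.
    by move=> /(_ _)/negP; apply; lia.
  by rewrite mem_iota subnK ?negbK => [? ?|]; [exists z | lia].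
have [w hw Exw] : exists2 w, x < w <= x + n & E x w.
  have /allPn[w] : ~~ closer n E x.
    rewrite cl_eq; apply/closerP => /(_ y); rewrite E'xy => /(_ _)/negP.
    by apply; lia.
  by rewrite mem_iota negbK addSn ltnS; exists w.
have le_zx : z <= x.
  rewrite leqNgt; apply/negP => lt_xz; have := gap z.
  by rewrite (bp_trans bpE' E'xy (sEE' _ _ Eyz)); lia.
have le_yw : y <= w.
  rewrite leqNgt; apply/negP => lt_wy; have := gap w.
  by rewrite (sEE' _ _ Exw); lia.
move: le_yw Eyz Exw; rewrite leq_eqVlt => /predU1P[-> // | lt_yw] Eyz Exw.
move: le_zx Eyz; rewrite leq_eqVlt (bp_sym bpE) => /predU1P[-> // | lt_zx] Ezy.
by rewrite (bp_trans bpE _ Ezy) // (bp_sym bpE) (ncE z x y w) //; lia.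
Qed.

(** * The walk of a pair of sets *)

Section Walk.
Variables (n : nat) (P Q : pred nat).

(* The walk steps up just before each point of [P] and down just after each
   point of [Q]: [level i] is its position before reaching [i], and [height i]
   its position at [i]. *)
Definition level (i : nat) : int :=
  (Posz (count P (iota 0 i)) - Posz (count Q (iota 0 i)))%R.

Definition height (i : nat) : int := (level i + Posz (P i))%R.

Lemma levelS i : (level i.+1 = height i - Posz (Q i))%R.
Proof.
by rewrite /height /level -addn1 iotaD !count_cat /= add0n; lia.
Qed.

Lemma level_interval a b : a <= b ->
  (level b - level a = Posz (count P (iota a (b - a))) -
     Posz (count Q (iota a (b - a))))%R.
Proof.
move=> le_ab; rewrite /level -{1 2}(subnKC le_ab) iotaD !count_cat add0n; lia.
Qed.

(** Between two points the walk is lowest at levels, reached after a possible step down and before a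
    possible step up, so only levels are tested. *)
Definition linked (i j : nat) : bool :=
  (height i == height j) &&
  all (fun r => height i <= level r)%R
    (iota (minn i j).+1 (maxn i j - minn i j)).

Lemma linkedP i j :
  reflect (height i = height j /\
    (forall r, minn i j < r <= maxn i j -> (height i <= level r)%R))
    (linked i j).
Proof.
apply: (iffP andP) => -[/eqP Hij h]; split=> //.
  by move=> r hr; apply: (allP h); rewrite mem_iota; lia.
by apply/allP => r; rewrite mem_iota => hr; apply: h; lia.
Qed.

Lemma linked_refl : reflexive linked.
Proof. by move=> i; apply/linkedP; split=> // r; lia. Qed.

Lemma linked_sym : symmetric linked.
Proof.
move=> i j; apply/linkedP/linkedP => -[Hij h]; split=> // r hr;
  by rewrite -?Hij; apply: h; rewrite minnC maxnC.
Qed.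

Lemma linked_trans : transitive linked.
Proof.
move=> j i k /linkedP[Hij hij] /linkedP[Hjk hjk]; apply/linkedP.
split=> [|r hr]; first by rewrite Hij.
have [h|h] : minn i j < r <= maxn i j \/ minn j k < r <= maxn j k by lia.
  exact: hij.
by rewrite Hij; apply: hjk.
Qed.

Hypothesis n_gt0 : 0 < n.
Hypothesis Pn : forall i, P (i + n) = P i.
Hypothesis Qn : forall i, Q (i + n) = Q i.
Hypothesis eqPQ : count P (iota 0 n) = count Q (iota 0 n).

Lemma level_bar i : level (i + n) = level i.
Proof.
have := level_interval (leq_addl n i); rewrite addnK.
have := level_interval (leq_addr n i).
rewrite addKn !count_period // eqPQ; lia.
Qed.

Lemma height_bar i : height (i + n) = height i.
Proof. by rewrite /height level_bar Pn. Qed.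

Lemma linked_bar i j : linked (i + n) (j + n) = linked i j.
Proof.
apply/linkedP/linkedP; rewrite !height_bar => -[Hij h]; split=> // r hr.
  by rewrite -level_bar; apply: h; lia.
have -> : r = r - n + n by lia.
by rewrite level_bar; apply: h; lia.
Qed.

Lemma level_turns i k : level (i + k * n.*2) = level i.
Proof.
elim: k => [|k <-]; first by rewrite addn0.
by rewrite -[in RHS]level_bar -[in RHS]level_bar; congr level; lia.
Qed.

Lemma height_turns i k : height (i + k * n.*2) = height i.
Proof.
elim: k => [|k <-]; first by rewrite addn0.
by rewrite -[in RHS]height_bar -[in RHS]height_bar; congr height; lia.
Qed.

Lemma linked_turns i j k : linked (i + k * n.*2) (j + k * n.*2) = linked i j.
Proof.
elim: k => [|k <-]; first by rewrite !addn0.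
by rewrite -[in RHS]linked_bar -[in RHS]linked_bar; congr linked; lia.
Qed.

Lemma linked_stop i j k : i <= j <= k -> height i = height j ->
  linked i k -> linked i j.
Proof.
move=> hij Hij /linkedP[_ h]; apply/linkedP; split=> // r hr.
by apply: h; lia.
Qed.

Lemma level_le_height i : (level i <= height i)%R.
Proof. by rewrite /height; lia. Qed.

(** The two links give height [p] <= level [q] <= height [q] <= level [r] <= height [r] = height
    [p], so [p] and [q] have equal heights. *)
Lemma linked_uncrossed p q r s : p < q -> q < r -> r < s ->
  linked p r -> linked q s -> linked p q.
Proof.
move=> lt_pq lt_qr lt_rs /linkedP[Hpr hpr] /linkedP[_ hqs].
have hq : (height p <= level q)%R by apply: hpr; lia.
have hr : (height q <= level r)%R by apply: hqs; lia.
have := level_le_height q; have := level_le_height r => lr lq.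
apply/linkedP; split=> [|t ht]; first by lia.
by apply: hpr; lia.
Qed.

(** [linked] lives on the line; this closes it under whole turns. Testing three translates keeps it
    boolean, and by [circP] they account for all translates. *)
Definition circ (i j : nat) : bool :=
  let i' := i %% n.*2 in let j' := j %% n.*2 in
  [|| linked i' j', linked i' (j' + n.*2) | linked (i' + n.*2) j'].

(** Heights being periodic, a link that spans several turns can be cut at an earlier translate of
    its far end. *)
Lemma circP i j :
  reflect (exists a b, linked (i + a * n.*2) (j + b * n.*2)) (circ i j).
Proof.
have di := divn_eq i n.*2; have dj := divn_eq j n.*2.
have n2_gt0 : 0 < n.*2 by rewrite double_gt0.
have := ltn_pmod i n2_gt0; have := ltn_pmod j n2_gt0; rewrite /circ.
set i' := i %% n.*2 in di *; set j' := j %% n.*2 in dj *.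
set a := i %/ n.*2 in di *; set b := j %/ n.*2 in dj *.
move=> lt_j lt_i; apply: (iffP or3P) => [h|[u [v]]].
  have {h} [c [d h]] : exists c d, linked (i' + c * n.*2) (j' + d * n.*2).
    by case: h => h; [exists 0, 0 | exists 0, 1 | exists 1, 0];
      rewrite ?mul1n ?addn0.
  exists (c + b), (d + a).
  have -> : i + (c + b) * n.*2 = i' + c * n.*2 + (a + b) * n.*2 by lia.
  have -> : j + (d + a) * n.*2 = j' + d * n.*2 + (a + b) * n.*2 by lia.
  by rewrite linked_turns.
have -> : i + u * n.*2 = i' + (u + a) * n.*2 by lia.
have -> : j + v * n.*2 = j' + (v + b) * n.*2 by lia.
move: (u + a) (v + b) => {}u {}v.
wlog le_uv : i' j' u v lt_i lt_j {di dj} / u <= v => [IH|].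
  have [/IH|/ltnW/IH] := leqP u v; first by apply.
  move=> {}IH; rewrite linked_sym => /IH[] // h; rewrite linked_sym in h.
  - exact: Or31.
  - exact: Or33.
  - exact: Or32.
rewrite -(subnK le_uv) mulnDl addnA linked_turns; case: (v - u) => [|[|d]] h.
- by apply: Or31; rewrite addn0 in h.
- by apply: Or32; rewrite mul1n in h.
- apply: Or32; apply: linked_stop (h); first by rewrite !mulSn; lia.
  have /linkedP[-> _] := h.
  by rewrite height_turns -[n.*2]mul1n height_turns.
Qed.

Lemma linked_circ i j : linked i j -> circ i j.
Proof. by move=> h; apply/circP; exists 0, 0; rewrite !addn0. Qed.

Lemma circ_bar_periodic : bar_periodic n circ.
Proof.
split.
- by move=> i; apply/linked_circ/linked_refl.
- move=> i j; apply/circP/circP => -[a [b h]]; exists b, a;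
    by rewrite linked_sym.
- move=> j i k /circP[a [b hij]] /circP[c [d hjk]]; apply/circP.
  exists (a + c), (d + b); apply: (linked_trans (y := j + (b + c) * n.*2)).
    by rewrite !mulnDl !addnA linked_turns.
  by rewrite (addnC b) !mulnDl !addnA linked_turns.
- move=> i j; apply/circP/circP => -[a [b h]]; exists a, b; move: h;
    by rewrite !(addnAC _ n) linked_bar.
- move=> i j; apply/circP/circP => -[a [b h]].
    by exists a, b.+1; rewrite mulSn addnA.
  exists a.+1, b; rewrite !mulSn [n.*2 + _]addnC (addnAC j) addnA.
  by have := linked_turns (i + a * n.*2) (j + b * n.*2) 1; rewrite mul1n => ->.
Qed.

Lemma circ_window i j : i < j < i + n.*2 ->
  circ i j -> linked i j \/ linked j (i + n.*2).
Proof.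
move=> hij /circP[a [b]]; have [le_ab | lt_ba] := leqP a b.
  rewrite -(subnK le_ab) mulnDl addnA linked_turns => h; left.
  apply: linked_stop (h); first by rewrite leq_addr andbT; lia.
  by have /linkedP[-> _] := h; rewrite height_turns.
rewrite -(subnK (ltnW lt_ba)) mulnDl addnA linked_turns => h; right.
have : 0 < a - b by rewrite subn_gt0.
move: h; case: (a - b) => // d h _.
apply: (linked_stop (k := i + d.+1 * n.*2)); rewrite 1?linked_sym //.
  by rewrite mulSn; lia.
by have /linkedP[<- _] := h; rewrite height_turns -[n.*2]mul1n height_turns.
Qed.

(** By [circ_window] each chord is a link either inside the window or through its end. In each of
    the four cases two links interleave on the line, and [linked_uncrossed] applies. *)
Lemma circ_uncrossed : uncrossed n circ.
Proof.
have [_ Csym Ctr _ Cturn] := circ_bar_periodic.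
move=> a b c d lt_ab lt_bc lt_cd lt_da Cac Cbd.
have [hac|hca] : linked a c \/ linked c (a + n.*2).
  by apply: circ_window => //; lia.
  have [hbd|hdb] : linked b d \/ linked d (b + n.*2).
      by apply: circ_window => //; lia.
    by apply/linked_circ/(linked_uncrossed lt_ab lt_bc lt_cd hac hbd).
  have /linked_circ : linked d (a + n.*2).
    apply: (linked_uncrossed (r := b + n.*2) (s := c + n.*2));
      rewrite ?ltn_add2r //.
    by have := linked_turns a c 1; rewrite mul1n => ->.
  by rewrite Cturn Csym => /Ctr; apply; rewrite Csym.
have [hbd|hdb] : linked b d \/ linked d (b + n.*2).
  by apply: circ_window => //; lia.
  have /linked_circ Cbc := linked_uncrossed lt_bc lt_cd lt_da hbd hca.
  by apply: (Ctr c) => //; rewrite Csym.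
have /linked_circ Ccd : linked c d.
  by apply: (linked_uncrossed lt_cd lt_da _ hca hdb); rewrite ltn_add2r.
by apply: (Ctr c) => //; apply: (Ctr d); rewrite // Csym.
Qed.

(** A point linked to its bar is linked to all its later translates by multiples of [n], so from
    there on the walk never sinks below its height. Two such points bound each other's heights,
    which are therefore equal. *)
Lemma circ_zero_uniq i j : circ i (i + n) -> circ j (j + n) -> circ i j.
Proof.
have zeroP k : circ k (k + n) -> linked k (k + n).
  have hk : k < k + n < k + n.*2 by lia.
  by case/(circ_window hk) => //; rewrite -addnn addnA linked_bar.
have zeroM k m : linked k (k + n) -> linked k (k + m * n).
  move=> hk; elim: m => [|m IHm]; first by rewrite addn0 linked_refl.
  by rewrite mulSn addnA; apply: (linked_trans hk); rewrite addnAC linked_bar.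
wlog le_ij : i j / i <= j => [IH|].
  have [/IH //|/ltnW/IH h Ci Cj] := leqP i j.
  by rewrite (bp_sym circ_bar_periodic) h.
(* The multiple [j.+1] is chosen so that [i + j.+1 * n] lies beyond [j]. *)
move=> /zeroP/(zeroM i j.+1)/linkedP[Hi hi].
move=> /zeroP/(zeroM j j.+1)/linkedP[Hj hj].
have lt_jn : j < j.+1 * n by rewrite leq_pmulr.
move: le_ij; rewrite leq_eqVlt => /predU1P[-> | lt_ij].
  exact: bp_refl circ_bar_periodic j.
have hij : (height i <= level j)%R by apply: hi; lia.
have hji : (height j <= level (i + j.+1 * n))%R by apply: hj; lia.
have := level_le_height j; have := level_le_height (i + j.+1 * n) => lj li.
apply: linked_circ; apply/linkedP; split=> [|r hr]; first by lia.
by apply: hi; lia.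
Qed.

(** If [P i], the level at every translate of [i] by a multiple of [n] is one below the height of
    [i], and a link from [i + n] to a [j] of the window would have to pass such a level. If not, the
    last [r] before [i + n] with height at most that of [i + n] is a mate within the window. *)
Lemma opener_circ i : opener n circ i = P i.
Proof.
apply/openerP/idP => [op_i | Pi j hj]; last first.
  apply/circP => -[a [b /linkedP[_]]].
  have Pi' k :
      (level (i + n + a * n.*2 + k * n) = height (i + n + a * n.*2) - 1)%R.
    elim: k => [|k <-]; last by rewrite mulSn addnCA addnC level_bar.
    rewrite addn0 height_turns height_bar level_turns level_bar /height Pi; lia.
  have [le_ba | lt_ab] := leqP b a.
    have := leq_mul le_ba (leqnn n.*2) => le2 /(_ (i + n + a * n.*2)).
    by have := Pi' 0; rewrite addn0; lia.
  have := leq_mul lt_ab (leqnn n.*2); rewrite mulSn => le2.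
  by move=> /(_ (i + n + a * n.*2 + 1 * n)); rewrite Pi'; lia.
apply: contraT => nPi.
have ex : exists r, (r < i + n) && (height r <= height (i + n))%R.
  by exists i; rewrite height_bar; lia.
have bnd r : (r < i + n) && (height r <= height (i + n))%R -> r <= i + n by lia.
case: (ex_maxnP ex bnd) => r /andP[lt_r le_r] maxr.
have le_ir : i <= r by apply: maxr; rewrite height_bar; lia.
have hlev t : r < t <= i + n -> (height (i + n) <= level t)%R.
  move=> ht; have [eq_t | ne_t] := eqVneq t (i + n).
    by rewrite eq_t /height Pn (negbTE nPi); lia.
  have := maxr t; rewrite /(height t); case: (P t); lia.
have /op_i/negP[] : i <= r < i + n by lia.
rewrite (bp_sym circ_bar_periodic); apply: linked_circ; apply/linkedP.
have := hlev r.+1; have := levelS r => lS hS.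
have eqH : height r = height (i + n) by lia.
by split=> // t ht; rewrite eqH; apply: hlev; lia.
Qed.

(** Mirror image: after a point of [Q] the level drops below its height; otherwise the first later
    point that is not higher is a mate. *)
Lemma closer_circ i : closer n circ i = Q i.
Proof.
apply/closerP/idP => [cl_i | Qi j hj]; last first.
  apply/circP => -[a [b /linkedP[_]]].
  have Qi' k : (level (i + k * n).+1 = height (i + a * n.*2) - 1)%R.
    elim: k => [|k <-]; last by rewrite mulSn addnCA addnC -addSn level_bar.
    by rewrite addn0 height_turns levelS Qi.
  have [le_ab | lt_ba] := leqP a b.
    have := leq_mul le_ab (leqnn n.*2) => le2 /(_ (i + a.*2 * n).+1).
    by rewrite Qi' -doubleMl doubleMr; lia.
  have := leq_mul lt_ba (leqnn n.*2); rewrite mulSn => le2.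
  move=> /(_ (i + b.*2.+1 * n).+1).
  by rewrite Qi' mulSn -doubleMl doubleMr; lia.
apply: contraT => nQi.
have lev_i : level i.+1 = height i by rewrite levelS (negbTE nQi); lia.
have ex : exists r, (i < r) && (height r <= height i)%R.
  by exists (i + n); rewrite height_bar; lia.
case: (ex_minnP ex) => r /andP[lt_r le_r] minr.
have le_ir : r <= i + n by apply: minr; rewrite height_bar; lia.
have hlev t : i < t <= r -> (height i <= level t)%R.
  move=> ht; have [eq_t | ne_t] := eqVneq t i.+1; first by rewrite eq_t lev_i.
  have -> : t = t.-1.+1 by lia.
  by have := minr t.-1; have := levelS t.-1; case: (Q _); lia.
have /cl_i/negP[] : i < r <= i + n by lia.
apply: linked_circ; apply/linkedP.
have := hlev r; have := level_le_height r => lS hS.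
by split=> [|t ht]; [lia | apply: hlev; lia].
Qed.

End Walk.

(* Between two consecutive points of a block all openers and closers are matched
   within the gap, so consecutive points are linked. *)
Theorem circ_opener_closer (n : nat) (E : rel nat) :
    0 < n -> bar_periodic n E -> uncrossed n E ->
  E =2 circ n (opener n E) (closer n E).
Proof.
move=> n_gt0 bpE ncE; set P := opener n E; set Q := closer n E.
have Pn : forall i, P (i + n) = P i := opener_bar bpE.
have Qn : forall i, Q (i + n) = Q i := closer_bar bpE.
have eqPQ : count P (iota 0 n) = count Q (iota 0 n) by rewrite count_closers.
have bpC := circ_bar_periodic n_gt0 Pn Qn eqPQ.
have opC i : opener n E i = opener n (circ n P Q) i by rewrite opener_circ.
have clC i : closer n E i = closer n (circ n P Q) i by rewrite closer_circ.
apply: (uncrossed_sub_eq n_gt0 bpE bpC ncE _ opC clC).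
apply: (consecutive_mates_ind n_gt0 bpE bpC) => a b le_na lt_ab le_b Eab gap.
apply: (linked_circ n_gt0 Pn Qn eqPQ).
have nQa : Q a = false.
  by apply/closerP => /(_ b); rewrite Eab; lia.
have nPb : P b = false.
  by apply/opener_backP => [||/(_ a)]; rewrite ?(bp_sym bpE b) ?Eab //; lia.
(* Each closer in the gap has its opener earlier in the gap, so the walk never sinks below its level
   at [a.+1]. *)
have cQP r : a < r <= b ->
    count Q (iota a.+1 (r - a.+1)) <= count P (iota a.+1 (r - a.+1)).
  move=> hr; apply: (leq_count_rel (r := E)); first exact: iota_uniq.
    move=> q; rewrite mem_iota => hq cl_q.
    have [|l [hl Eql op_l]] := opener_inside bpE ncE le_na _ le_b Eab gap cl_q.
      by lia.
    by exists l; rewrite ?mem_iota ?Eql ?[P l]op_l //; lia.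
  move=> x y z; rewrite !mem_iota => hx hy cl_x cl_y Exz Eyz.
  have Exy : E x y by apply: (bp_trans bpE Exz); rewrite (bp_sym bpE).
  have Eyx : E y x by rewrite (bp_sym bpE).
  have := closers_uniq bpE cl_x cl_y; have := closers_uniq bpE cl_y cl_x.
  by rewrite Exy Eyx; lia.
(* Each opener in the gap has its closer in the gap; with [cQP b] the whole gap is balanced, so [a]
   and [b] have equal heights. *)
have cPQ : count P (iota a.+1 (b - a.+1)) <= count Q (iota a.+1 (b - a.+1)).
  apply: (leq_count_rel (r := E)); first exact: iota_uniq.
    move=> l; rewrite mem_iota => hl op_l.
    have [|q [hq Elq cl_q]] := closer_inside bpE ncE _ le_b Eab gap op_l.
      by lia.
    by exists q; rewrite ?mem_iota ?Elq ?[Q q]cl_q //; lia.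
  move=> x y z; rewrite !mem_iota => hx hy op_x op_y Exz Eyz.
  have Exy : E x y by apply: (bp_trans bpE Exz); rewrite (bp_sym bpE).
  have Eyx : E y x by rewrite (bp_sym bpE).
  have := openers_uniq bpE op_x op_y; have := openers_uniq bpE op_y op_x.
  by rewrite Exy Eyx; lia.
have lev_a : level P Q a.+1 = height P Q a by rewrite levelS nQa; lia.
apply/linkedP; split=> [|r hr].
  have := level_interval P Q lt_ab; have := cQP b.
  by rewrite /(height _ _ b) nPb; lia.
have lt_ar : a < r by lia.
have := level_interval P Q lt_ar; have := cQP r; lia.
Qed.

Lemma eq_circ (n : nat) (P P' Q Q' : pred nat) :
  P =1 P' -> Q =1 Q' -> circ n P Q =2 circ n P' Q'.
Proof.
move=> eqP eqQ i j.
have eqL : level P Q =1 level P' Q'.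
  by move=> k; rewrite /level (eq_count eqP) (eq_count eqQ).
have eqH : height P Q =1 height P' Q' by move=> k; rewrite /height eqL eqP.
have eqE : linked P Q =2 linked P' Q'.
  move=> k l; rewrite /linked !eqH; congr (_ && _).
  by apply: eq_all => r; rewrite eqL.
by rewrite /circ !eqE.
Qed.

Lemma barK (n : nat) : involutive (@bar n).
Proof. by case=> i b; rewrite /bar /= negbK. Qed.

Lemma bar_blockK (n : nat) : involutive (@bar_block n).
Proof.
move=> B; apply/setP => x; apply/imsetP/idP => [[_ /imsetP[z Bz ->] ->]|Bx].
  by rewrite barK.
by exists (bar x); rewrite ?barK // imset_f.
Qed.

(** * Noncrossing partitions *)

Section Unroll.
Variable n : nat.
Hypothesis n_gt0 : 0 < n.

Definition letter_at (i : nat) : letter n :=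
  (Ordinal (ltn_pmod i n_gt0), odd (i %/ n)).

Lemma letter_at_bar i : letter_at (i + n) = bar (letter_at i).
Proof.
rewrite /letter_at /bar /= divnDr ?dvdnn // divnn n_gt0 addn1; congr pair.
by apply: val_inj; rewrite /= modnDr.
Qed.

Lemma letter_at_turn i : letter_at (i + n.*2) = letter_at i.
Proof. by rewrite -addnn addnA !letter_at_bar barK. Qed.

Lemma place_lt (x : letter n) : place x < n.*2.
Proof.
by rewrite /place; case: x => i []; have := ltn_ord i; rewrite /=; lia.
Qed.

Lemma placeK : cancel (@place n) letter_at.
Proof.
case=> i []; rewrite /place /letter_at /=; congr pair.
- by apply: val_inj; rewrite /= modnDl modn_small.
- by rewrite divnDl ?dvdnn // divnn n_gt0 divn_small.
- by apply: val_inj; rewrite /= modn_small.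
- by rewrite divn_small.
Qed.

Lemma letter_at_fst (x : letter n) : letter_at x.1 = if x.2 then bar x else x.
Proof. by case: x => i b; rewrite (placeK (i, false)); case: b. Qed.

Lemma letter_atK i : place (letter_at i) = i %% n.*2.
Proof.
rewrite -[in LHS](periodic_mod letter_at_turn).
have : i %% n.*2 < n.*2 by rewrite ltn_pmod // double_gt0.
move: (i %% _) => {}i lt_i; rewrite /place /letter_at /barred /=.
have [lt_in | le_ni] := ltnP i n; first by rewrite divn_small //= modn_small.
have -> : i = i - n + n by lia.
have lt_in : i - n < n by lia.
rewrite divnDr ?dvdnn // divnn n_gt0 divn_small // modnDr.
by rewrite modn_small //= addnC.
Qed.

Lemma clockwise_letters a b c d : a < b -> b < c -> c < d -> d < a + n.*2 ->
  clockwise [:: letter_at a; letter_at b; letter_at c; letter_at d].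
Proof.
move=> ab bc cd da; rewrite /clockwise /= /rot /= !letter_atK.
have n2_gt0 : 0 < n.*2 by rewrite double_gt0.
have := divn_eq a n.*2; have := ltn_pmod a n2_gt0.
move: (a %/ _) => q lt_a eq_a.
have md1 k : q * n.*2 <= k < q.+1 * n.*2 -> k %% n.*2 = k - q * n.*2.
  rewrite mulSn => hk; rewrite -{1}(subnKC (_ : q * n.*2 <= k)); last by lia.
  by rewrite modnMDl modn_small //; lia.
have md2 k : q.+1 * n.*2 <= k < a + n.*2 -> k %% n.*2 = k - q.+1 * n.*2.
  rewrite mulSn => hk; rewrite -{1}(subnKC (_ : q.+1 * n.*2 <= k)).
    by rewrite modnMDl modn_small // mulSn; lia.
  by rewrite mulSn; lia.
rewrite !andbT orbF (md1 a) ?mulSn; last by lia.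
(* The first of [b], [c], [d] to pass the end of the turn of [a] determines the rotation. *)
have [lt_b | le_b] := ltnP b (q.+1 * n.*2); last first.
  rewrite !md2; lia.
have [lt_c | le_c] := ltnP c (q.+1 * n.*2); last first.
  rewrite (md1 b) ?(md2 c) ?(md2 d); lia.
have [lt_d | le_d] := ltnP d (q.+1 * n.*2); last first.
  rewrite (md1 b) ?(md1 c) ?(md2 d); lia.
rewrite !md1; lia.
Qed.

(** The letters whose places come before that of [a] in the rotated sequence are moved one turn
    ahead. *)
Lemma clockwise_places (a b c d : letter n) : clockwise [:: a; b; c; d] ->
  exists i j k l, [/\ [/\ i < j, j < k, k < l & l < i + n.*2],
    letter_at i = a, letter_at j = b, letter_at k = c & letter_at l = d].
Proof.
have := place_lt a; have := place_lt b; have := place_lt c; have := place_lt d.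
move=> ld lc lb la; rewrite /clockwise /= /rot /= !andbT orbF.
case/or4P => /and3P[h1 h2 h3].
- exists (place a), (place b), (place c), (place d).
  by rewrite !placeK; do !split; lia.
- exists (place a), (place b + n.*2), (place c + n.*2), (place d + n.*2).
  by rewrite !letter_at_turn !placeK; do !split; lia.
- exists (place a), (place b), (place c + n.*2), (place d + n.*2).
  by rewrite !letter_at_turn !placeK; do !split; lia.
- exists (place a), (place b), (place c), (place d + n.*2).
  by rewrite !letter_at_turn !placeK; do !split; lia.
Qed.


Definition mates (pi : {set {set letter n}}) (i j : nat) : bool :=
  pblock pi (letter_at i) == pblock pi (letter_at j).

Section Blocks.
Variable pi : NCB n.

Lemma ncb_partition : partition pi [set: letter n].
Proof. by case: pi => x /= /andP[/and3P[]]. Qed.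

Lemma ncb_trivI : trivIset pi.
Proof. by case/and3P: ncb_partition. Qed.

Lemma mem_ncb_pblock x : x \in pblock pi x.
Proof. by rewrite mem_pblock (cover_partition ncb_partition). Qed.

Lemma ncb_pblock_mem x : pblock pi x \in val pi.
Proof. by rewrite pblock_mem // (cover_partition ncb_partition). Qed.

Lemma ncb_def_pblock B x : B \in val pi -> x \in B -> pblock pi x = B.
Proof. exact: def_pblock ncb_trivI. Qed.

Lemma ncb_bar_block B : B \in val pi -> bar_block B \in val pi.
Proof.
move=> piB; case: pi piB => x /= /andP[/and3P[_ /forall_inP h _] _].
exact: h.
Qed.

Lemma pblock_bar x : pblock pi (bar x) = bar_block (pblock pi x).
Proof.
apply: ncb_def_pblock; first exact/ncb_bar_block/ncb_pblock_mem.
by rewrite imset_f // mem_ncb_pblock.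
Qed.

Lemma mates_bar_periodic : bar_periodic n (mates pi).
Proof.
split.
- by move=> i; rewrite /mates.
- by move=> i j; rewrite /mates eq_sym.
- by move=> j i k /eqP eij /eqP ejk; rewrite /mates eij ejk.
- move=> i j; rewrite /mates !letter_at_bar !pblock_bar.
  exact: (inj_eq (can_inj (@bar_blockK n))).
- by move=> i j; rewrite /mates letter_at_turn.
Qed.

Lemma mates_uncrossed : uncrossed n (mates pi).
Proof.
move=> a b c d ab bc cd da /eqP eac /eqP ebd; apply: contraT => neB.
have /andP[_ /forall_inP nc] : typeB_partition (val pi) && noncrossing (val pi).
  exact: valP pi.
have /forall_inP/(_ _ (ncb_pblock_mem (letter_at b))) :=
  nc _ (ncb_pblock_mem (letter_at a)).
move=> /implyP/(_ neB)/forallP/(_ (letter_at a))/forallP/(_ (letter_at b)).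
move=> /forallP/(_ (letter_at c))/forallP/(_ (letter_at d))/implyP.
rewrite clockwise_letters // => /(_ isT)/negP[].
by rewrite {2}eac {2}ebd !mem_ncb_pblock.
Qed.

Lemma mates_place x y : mates pi (place x) (place y) = (y \in pblock pi x).
Proof.
rewrite /mates !placeK eq_pblock ?ncb_trivI //.
by rewrite (cover_partition ncb_partition).
Qed.

Definition openers : {set 'I_n} := [set i : 'I_n | opener n (mates pi) i].
Definition closers : {set 'I_n} := [set i : 'I_n | closer n (mates pi) i].

Lemma mem_openers i :
  ((letter_at i).1 \in openers) = opener n (mates pi) i.
Proof. by rewrite inE /= (periodic_mod (opener_bar mates_bar_periodic)). Qed.

Lemma mem_closers i :
  ((letter_at i).1 \in closers) = closer n (mates pi) i.
Proof. by rewrite inE /= (periodic_mod (closer_bar mates_bar_periodic)). Qed.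

Lemma card_openers : #|openers| = #|closers|.
Proof.
rewrite /openers /closers (card_ord_pred n (opener n (mates pi))).
rewrite (card_ord_pred n (closer n (mates pi))) count_closers //.
exact: mates_bar_periodic.
Qed.

Lemma ncb_equivalence :
  val pi = equivalence_partition
    (fun x y : letter n => mates pi (place x) (place y)) [set: letter n].
Proof.
rewrite -[LHS](equivalence_partition_pblock ncb_partition).
by apply: eq_imset => x; apply/setP => y; rewrite !inE mates_place.
Qed.

(* Each opener is the first point of exactly one of the two blocks of a pair. *)
Lemma ncb_rankE : ncb_rank pi = n - #|openers|.
Proof.
have bp := mates_bar_periodic; congr (n - _).
pose f (i : 'I_n) :=
  [set pblock pi (letter_at i); bar_block (pblock pi (letter_at i))].
rewrite -(card_in_imset (f := f) (D := openers)); last first.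
  move=> i j; rewrite !inE => op_i op_j /setP/(_ (pblock pi (letter_at i))).
  rewrite !inE eqxx /= => /esym hij; apply: val_inj => /=.
  apply: (separated_mod bp (opener_bar bp) (openers_uniq bp)) => //.
  by rewrite /mates letter_at_bar pblock_bar.
apply: eq_card => p; apply/imsetP/imsetP => [[B]|[i op_i ->]].
  rewrite inE => /andP[piB nzB] ->.
  have /set0Pn[x Bx] : B != set0.
    by apply: contraNneq nzB => ->; rewrite /bar_block imset0.
  have pBx : pblock pi (letter_at (place x + n.*2)) = B.
    by rewrite letter_at_turn placeK; apply: ncb_def_pblock.
  have [||l] := opener_exists bp mates_uncrossed (_ : n.*2 <= place x + n.*2).
  - exact: leq_addl.
  - rewrite /mates letter_at_bar pblock_bar pBx eq_sym; exact: nzB.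
  rewrite {1}/mates pBx => /eqP eqB op_l; exists (letter_at l).1.
    by rewrite mem_openers.
  (* Dropping the bar of [letter_at l] may replace [B] by [bar_block B], which leaves the pair
     unchanged. *)
  rewrite /f letter_at_fst; case: ifP => _; rewrite ?pblock_bar -eqB //.
  by rewrite bar_blockK setUC.
exists (pblock pi (letter_at i)); last by [].
rewrite inE ncb_pblock_mem /=; apply: contraTneq op_i => eqB.
rewrite inE; apply/openerP => /(_ (nat_of_ord i)).
rewrite leqnn -[X in X < _]addn0 ltn_add2l n_gt0 => /(_ isT).
by rewrite /mates letter_at_bar pblock_bar eqB eqxx.
Qed.

End Blocks.

Lemma refines_mates (pi pi' : NCB n) :
  refines (val pi) (val pi') -> subrel (mates pi) (mates pi').
Proof.
move=> /forall_inP r i j /eqP eij.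
have /existsP[S /andP[/subsetP sS /eqP dS]] :=
  r _ (ncb_pblock_mem pi' (letter_at i)).
have := mem_ncb_pblock pi' (letter_at i); rewrite -dS => /bigcupP[A SA Ai].
apply/eqP; symmetry; apply: (ncb_def_pblock (ncb_pblock_mem pi' (letter_at i))).
rewrite -dS; apply/bigcupP; exists A => //.
by rewrite -(ncb_def_pblock (sS _ SA) Ai) eij mem_ncb_pblock.
Qed.

Lemma openers_closers_inj (pi pi' : NCB n) :
  openers pi = openers pi' -> closers pi = closers pi' -> pi = pi'.
Proof.
move=> eqO eqC; apply: val_inj.
rewrite [LHS]ncb_equivalence [RHS]ncb_equivalence.
have mE p : mates (val p) =2 _ :=
  circ_opener_closer n_gt0 (mates_bar_periodic p) (@mates_uncrossed p).
have opE : opener n (mates pi) =1 opener n (mates pi').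
  by move=> i; rewrite -!mem_openers eqO.
have clE : closer n (mates pi) =1 closer n (mates pi').
  by move=> i; rewrite -!mem_closers eqC.
apply: eq_imset => x; apply/setP => y; rewrite !inE !mE.
exact: eq_circ.
Qed.

Lemma openers_anti (pi pi' : NCB n) :
  (pi <= pi')%O -> openers pi' \subset openers pi.
Proof.
move=> /refines_mates le; apply/subsetP => i; rewrite !inE => /openerP op_i.
by apply/openerP => j /op_i; apply: contra; apply: le.
Qed.

Lemma closers_anti (pi pi' : NCB n) :
  (pi <= pi')%O -> closers pi' \subset closers pi.
Proof.
move=> /refines_mates le; apply/subsetP => i; rewrite !inE => /closerP op_i.
by apply/closerP => j /op_i; apply: contra; apply: le.
Qed.

(** If the openers agreed, the closers, being nested and equal in number, would agree too, and then
    [pi = pi']. *)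
Lemma openers_proper (pi pi' : NCB n) :
  (pi < pi')%O -> openers pi' \proper openers pi.
Proof.
move=> lt; have le := ltW lt; rewrite properEneq openers_anti // andbT.
apply: contraTneq lt => eqO.
suff -> : pi = pi' by rewrite ltxx.
apply: openers_closers_inj => //; apply/esym/eqP.
rewrite eqEcard (closers_anti le) -(card_openers pi) -(card_openers pi').
by rewrite eqO leqnn.
Qed.

(** * The noncrossing partition with prescribed openers and closers *)

Section Realize.
Variables (A B : {set 'I_n}).
Hypothesis eqAB : #|A| = #|B|.

Let P i := (letter_at i).1 \in A.
Let Q i := (letter_at i).1 \in B.
Let E := circ n P Q.

Let Pn i : P (i + n) = P i.
Proof. by rewrite /P letter_at_bar. Qed.

Let Qn i : Q (i + n) = Q i.
Proof. by rewrite /Q letter_at_bar. Qed.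

Lemma letter_at_ord (i : 'I_n) : (letter_at i).1 = i.
Proof. by apply: val_inj; rewrite /= modn_small. Qed.

Let eqPQ : count P (iota 0 n) = count Q (iota 0 n).
Proof.
rewrite -!card_ord_pred; transitivity #|A|; last rewrite eqAB;
  by apply: eq_card => i; rewrite inE ?/P ?/Q letter_at_ord.
Qed.

Let bpE : bar_periodic n E := circ_bar_periodic n_gt0 Pn Qn eqPQ.

Let R := fun x y : letter n => E (place x) (place y).

Let R_equiv : {in [set: letter n] & &, equivalence_rel R}.
Proof.
move=> x y z _ _ _; split; first exact: bp_refl bpE _.
move=> Rxy; apply/idP/idP; last exact: (bp_trans bpE Rxy).
by apply: (bp_trans bpE); rewrite (bp_sym bpE).
Qed.

Let pi := equivalence_partition R [set: letter n].

Let pi_part : partition pi [set: letter n].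
Proof. exact: equivalence_partitionP R_equiv. Qed.

Let memR x y : (y \in pblock pi x) = R x y.
Proof. by rewrite pblock_equivalence_partition ?inE. Qed.

Let E_place i j : E (place (letter_at i)) (place (letter_at j)) = E i j.
Proof. by rewrite !letter_atK (bp_mod bpE). Qed.

Let pblock_R x : pblock pi x = [set y | R x y].
Proof. by apply/setP => y; rewrite memR inE. Qed.

Let blockR C x : C \in pi -> x \in C -> C = [set y | R x y].
Proof.
move=> piC Cx; rewrite -pblock_R; apply/esym/def_pblock => //.
by case/and3P: pi_part.
Qed.

Let R_bar x y : R (bar x) (bar y) = R x y.
Proof.
rewrite -[x]placeK -[y]placeK -!letter_at_bar /R !E_place.
exact: bp_bar bpE _ _.
Qed.

Let block_bar C x : C \in pi -> x \in C -> bar_block C = [set y | R (bar x) y].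
Proof.
move=> piC Cx; rewrite (blockR piC Cx); apply/setP => y; rewrite inE.
apply/imsetP/idP => [[z + ->]|]; first by rewrite inE R_bar.
by rewrite -{1}[y](@barK n) R_bar => Rxy; exists (bar y); rewrite ?barK ?inE.
Qed.

Let block_neq0 C : C \in pi -> exists x, x \in C.
Proof.
move=> piC; apply/set0Pn; apply: contraTneq piC => ->.
by case/and3P: pi_part.
Qed.

Let block_eq C D x y :
  C \in pi -> D \in pi -> x \in C -> y \in D -> R x y -> C = D.
Proof.
move=> piC piD Cx Dy Rxy; rewrite (blockR piC Cx) (blockR piD Dy).
apply/setP => z; rewrite !inE.
by have [_] := R_equiv (in_setT x) (in_setT y) (in_setT z); apply.
Qed.

Let zero_block C x : C \in pi -> x \in C -> bar_block C = C ->
  E (place x) (place x + n).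
Proof.
move=> piC Cx bC; have : R (bar x) x.
  by have := Cx; rewrite -{1}bC (block_bar piC Cx) inE.
rewrite -{1 2}[x]placeK -letter_at_bar /R !E_place.
by rewrite (bp_sym bpE).
Qed.

Let pi_typeB : typeB_partition pi.
Proof.
apply/and3P; split=> //.
  apply/forall_inP => C piC; have [x Cx] := block_neq0 piC.
  rewrite (block_bar piC Cx) -pblock_R pblock_mem //.
  by rewrite (cover_partition pi_part) inE.
apply/card_le1_eqP => C D; rewrite !inE.
move=> /andP[piC /eqP bC] /andP[piD /eqP bD].
have [x Cx] := block_neq0 piC; have [y Dy] := block_neq0 piD.
apply/esym/(block_eq piC piD Cx Dy); apply: (circ_zero_uniq n_gt0 Pn Qn eqPQ).
  exact: zero_block piC Cx bC.
exact: zero_block piD Dy bD.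
Qed.

Let pi_noncrossing : noncrossing pi.
Proof.
apply/forall_inP => C piC; apply/forall_inP => D piD; apply/implyP => neCD.
apply/forallP => a; apply/forallP => b; apply/forallP => c; apply/forallP => d.
apply/implyP => /clockwise_places[i [j [k [l [[ij jk kl li] ea eb ec ed]]]]].
apply: contra neCD => /and4P[Ca Cc Db Dd].
have Rac : R a c by move: Cc; rewrite (blockR piC Ca) inE.
have Rbd : R b d by move: Dd; rewrite (blockR piD Db) inE.
apply/eqP/(block_eq piC piD Ca Db); move: Rac Rbd.
rewrite -ea -eb -ec -ed /R !E_place.
exact: (circ_uncrossed n_gt0 Pn Qn eqPQ).
Qed.

(** The classes of [circ], read on the places, are permuted by the bar, do not cross, and include at
    most one zero class by [circ_zero_uniq]; [opener_circ] and [closer_circ] recover [A] and [B]. *)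
Lemma ncb_realize : exists p : NCB n, openers p = A /\ closers p = B.
Proof.
have pP : typeB_partition pi && noncrossing pi.
  by rewrite pi_typeB pi_noncrossing.
exists (MkNCB pP).
have mE : mates pi =2 E.
  move=> i j; rewrite -E_place /mates eq_pblock.
  - exact: memR.
  - by case/and3P: pi_part.
  - by rewrite (cover_partition pi_part) inE.
have eqop : opener n (mates pi) =1 opener n E.
  by move=> i; apply: eq_all => j; rewrite /= mE.
have eqcl : closer n (mates pi) =1 closer n E.
  by move=> i; apply: eq_all => j; rewrite /= mE.
split; apply/setP => i; rewrite inE /=.
  by rewrite eqop (opener_circ n_gt0 Pn Qn eqPQ) /P letter_at_ord.
by rewrite eqcl (closer_circ n_gt0 Pn Qn eqPQ) /Q letter_at_ord.
Qed.

End Realize.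

End Unroll.

(** * Avoiding signed permutations *)

Lemma sorted_enum_ord (n : nat) (A : {set 'I_n}) :
  sorted (fun i j : 'I_n => i < j) (enum A).
Proof.
rewrite /enum_mem -enumT; apply: sorted_filter.
  by move=> j i k; apply: ltn_trans.
by have := iota_ltn_sorted 0 n; rewrite -val_enum_ord sorted_map.
Qed.

Lemma eq_card_setC (T : finType) (A B : {set T}) :
  #|A| = #|B| -> #|~: A| = #|~: B|.
Proof. by move=> eqAB; apply: (@addnI #|A|); rewrite cardsC eqAB cardsC. Qed.

Lemma increasing_matching (n : nat) (A B : {set 'I_n}) : #|A| = #|B| ->
  exists f : 'I_n -> 'I_n, {in A, forall i, f i \in B} /\
    {in A &, forall i j : 'I_n, i < j -> f i < f j}.
Proof.
move=> eqAB; have tr : transitive (fun i j : 'I_n => i < j).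
  by move=> j i k; apply: ltn_trans.
(* The element of [A] of a given rank goes to the element of [B] of the same rank; on [A] the
   default of [nth] is never reached. *)
exists (fun i => nth i (enum B) (index i (enum A))).
have szB i : i \in A -> index i (enum A) < size (enum B).
  by move=> Ai; rewrite -cardE -eqAB cardE index_mem mem_enum.
split=> [i Ai | i j Ai Aj lt_ij]; first by rewrite -mem_enum mem_nth ?szB.
rewrite (set_nth_default i j) ?szB //.
apply: (sorted_ltn_nth tr _ (sorted_enum_ord B)); rewrite ?inE ?szB //.
have h : index j (enum A) < index i (enum A) -> j < i.
  by apply: (sorted_ltn_index tr (sorted_enum_ord A)); rewrite mem_enum.
rewrite ltnNge leq_eqVlt negb_or.
rewrite andbC; apply/andP; split; first by apply/negP => /h; lia.
apply/negP => /eqP/(congr1 (nth i (enum A))).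
by rewrite !nth_index ?mem_enum // => eq_ij; rewrite eq_ij ltnn in lt_ij.
Qed.

Lemma perm_matching (n : nat) (A B : {set 'I_n}) : #|A| = #|B| ->
  exists s : {perm 'I_n}, [/\ s @: A = B,
    {in A &, forall i j : 'I_n, i < j -> s i < s j} &
    {in ~: A &, forall i j : 'I_n, i < j -> s i < s j}].
Proof.
move=> eqAB; have eqCAB := eq_card_setC eqAB.
have [f [fB fmono]] := increasing_matching eqAB.
have [g [gB gmono]] := increasing_matching eqCAB.
pose h i := if i \in A then f i else g i.
have hA i : (h i \in B) = (i \in A).
  rewrite /h; case: ifP => [Ai | nAi]; first exact: fB.
  by apply/negbTE; rewrite -in_setC gB // in_setC nAi.
have hmA : {in A &, forall i j : 'I_n, i < j -> h i < h j}.
  by move=> i j Ai Aj; rewrite /h Ai Aj; apply: fmono.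
have hmC : {in ~: A &, forall i j : 'I_n, i < j -> h i < h j}.
  by move=> i j; rewrite !inE /h => nAi nAj; rewrite (negbTE nAi) (negbTE nAj);
    apply: gmono; rewrite inE.
have h_inj : injective h.
  move=> i j eq_h; have eqA : (i \in A) = (j \in A) by rewrite -!hA eq_h.
  apply: val_inj; have [Ai | nAi] := boolP (i \in A).
    have Aj : j \in A by rewrite -eqA.
    by have := hmA i j Ai Aj; have := hmA j i Aj Ai; rewrite eq_h /=; lia.
  have Ci : i \in ~: A by rewrite inE.
  have Cj : j \in ~: A by rewrite inE -eqA.
  by have := hmC i j Ci Cj; have := hmC j i Cj Ci; rewrite eq_h /=; lia.
exists (perm h_inj); split; first last.
- by move=> i j Ai Aj; rewrite !permE; apply: hmC.
- by move=> i j Ai Aj; rewrite !permE; apply: hmA.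
apply/eqP; rewrite eqEcard card_imset ?eqAB ?leqnn ?andbT; last exact: perm_inj.
by apply/subsetP => _ /imsetP[i Ai ->]; rewrite permE hA.
Qed.

(** Strong induction on [i]. If [f i = g j] with [j < i], then [f j = g j = f i] contradicts
    monotonicity; so [i <= j] and [g i <= f i]. The converse inequality is symmetric. *)
Lemma increasing_eq_image (n : nat) (A : {set 'I_n}) (f g : 'I_n -> 'I_n) :
    {in A &, forall i j : 'I_n, i < j -> f i < f j} ->
    {in A &, forall i j : 'I_n, i < j -> g i < g j} ->
  f @: A = g @: A -> {in A, f =1 g}.
Proof.
move=> fmono gmono eq_fg i.
have [m] := ubnP i; elim: m i => // m IHm i lt_im Ai; apply: val_inj.
have le_of (u v : 'I_n -> 'I_n) : u @: A = v @: A ->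
    {in A &, forall i j : 'I_n, i < j -> u i < u j} ->
    {in A &, forall i j : 'I_n, i < j -> v i < v j} ->
    (forall j : 'I_n, j < i -> j \in A -> u j = v j) -> v i <= u i.
  move=> eq_uv um vm IH; have : u i \in v @: A by rewrite -eq_uv imset_f.
  case/imsetP => j Aj eq_ui; have [lt_ji | lt_ij | eq_ij] := ltngtP j i.
  - by have := um j i Aj Ai lt_ji; rewrite eq_ui IH // ltnn.
  - by rewrite eq_ui ltnW // vm.
  - by rewrite eq_ui (val_inj eq_ij).
apply/eqP; rewrite eqn_leq !le_of // => j lt_ji Aj; last apply/esym;
  by apply: IHm => //; lia.
Qed.

Section SignedPermutations.
Variable n : nat.

Definition barred_symbols (b : n.-tuple (letter n)) : {set 'I_n} :=
  [set (tnth b i).1 | i in Des b].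

Section Word.
Variable b : PB n.

Lemma symbol_inj : injective (fun i => (tnth b i).1).
Proof.
have /andP[/forallP sb _] : signed_perm (val b) && avoiding (val b) := valP b.
have : uniq [seq x.1 | x <- val b].
  apply: count_mem_uniq => k; rewrite (eqP (sb k)); apply/esym/eqP.
  by rewrite eqb1 -has_pred1 has_count (eqP (sb k)).
move=> u; have /tuple_uniqP inj : uniq (map_tuple fst (val b)) by [].
by move=> i j /= eq_ij; apply: inj; rewrite !tnth_map.
Qed.

Lemma symbol_increasing i j : barred (tnth b i) = barred (tnth b j) ->
  i < j -> (tnth b i).1 < (tnth b j).1.
Proof.
move=> eqb lt_ij.
have /andP[_ /existsPn nav] : signed_perm (val b) && avoiding (val b) := valP b.
have /existsPn/(_ j) := nav i; rewrite lt_ij eqb eqxx /= -leqNgt.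
rewrite leq_eqVlt => /predU1P[/val_inj/symbol_inj eq_ij|//].
by rewrite eq_ij ltnn in lt_ij.
Qed.

(** In the chain every barred letter lies above every unbarred one, and barred letters decrease as
    their symbols increase. Avoidance makes symbols increase within each kind, so a barred letter
    exceeds whatever follows it and an unbarred one never does. *)
Lemma mem_Des i : (i \in Des b) = barred (tnth b i).
Proof.
rewrite inE; have [bi | nbi] := boolP (barred (tnth b i)).
  have [-> | ne_n] := eqVneq i.+1 n; first by rewrite orbT.
  have lt_n : i.+1 < n by have := ltn_ord i; lia.
  rewrite orbF; apply/existsP; exists (Ordinal lt_n); rewrite eqxx /=.
  have := @symbol_increasing i (Ordinal lt_n); rewrite bi /key bi /= ltnSn.
  have := ltn_ord (tnth b i).1; have := ltn_ord (tnth b (Ordinal lt_n)).1.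
  by case: ifP => _ ltj lti; [move/(_ erefl isT) | move=> _]; lia.
rewrite andbF orbF; apply/existsP => -[j /andP[/eqP eq_j]].
have := @symbol_increasing i j.
rewrite (negbTE nbi) /key (negbTE nbi) eq_j ltnSn.
have := ltn_ord (tnth b i).1; have := ltn_ord (tnth b j).1.
by case: ifP => _ ltj lti; [move=> _ | move/(_ erefl isT)]; lia.
Qed.

Lemma card_barred_symbols : #|barred_symbols b| = #|Des b|.
Proof. exact: card_imset symbol_inj. Qed.

Lemma unbarred_symbols :
  [set (tnth b i).1 | i in ~: Des b] = ~: barred_symbols b.
Proof.
apply/eqP; rewrite eqEcard (card_imset _ symbol_inj) cardsCs setCK.
rewrite [X in _ && (_ <= X)]cardsCs setCK card_barred_symbols leqnn andbT.
apply/subsetP => _ /imsetP[i nDi ->]; rewrite inE; apply: contraL nDi.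
by case/imsetP => j Dj /symbol_inj ->; rewrite inE negbK.
Qed.

End Word.

(** Symbols increase along the barred positions and along the unbarred ones, so each half is
    determined by its set of symbols. *)
Lemma pb_inj (b b' : PB n) :
  Des b = Des b' -> barred_symbols b = barred_symbols b' -> b = b'.
Proof.
move=> eqD eqS; apply/val_inj/eq_from_tnth => i.
have eqb j : barred (tnth b j) = barred (tnth b' j) by rewrite -!mem_Des eqD.
suff eqs : (tnth b i).1 = (tnth b' i).1.
  rewrite [LHS]surjective_pairing [RHS]surjective_pairing eqs.
  by rewrite -[(tnth b i).2]/(barred _) eqb.
have incr (c : PB n) (D : {set 'I_n}) :
    {in D &, forall i j, barred (tnth c i) = barred (tnth c j)} ->
    {in D &, forall i j : 'I_n, i < j -> (tnth c i).1 < (tnth c j).1}.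
  by move=> eqc k l Dk Dl; apply/symbol_increasing/eqc.
have [Di | nDi] := boolP (i \in Des b).
  apply: (increasing_eq_image (A := Des b) (f := fun i => (tnth b i).1)
    (g := fun i => (tnth b' i).1)) => //.
  - by apply: incr => k l; rewrite !mem_Des => -> ->.
  - by apply: incr => k l; rewrite eqD !mem_Des => -> ->.
  - by rewrite -[LHS]/(barred_symbols b) eqS eqD.
apply: (increasing_eq_image (A := ~: Des b) (f := fun i => (tnth b i).1)
    (g := fun i => (tnth b' i).1)); rewrite ?in_setC //.
- by apply: incr => k l; rewrite !in_setC !mem_Des => /negbTE-> /negbTE->.
- by apply: incr => k l; rewrite eqD !in_setC !mem_Des => /negbTE-> /negbTE->.
- by rewrite unbarred_symbols eqD unbarred_symbols eqS.
Qed.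

Lemma pb_realize (A B : {set 'I_n}) : #|A| = #|B| ->
  exists b : PB n, Des b = A /\ barred_symbols b = B.
Proof.
move=> eqAB; have [s [sA smA smC]] := perm_matching eqAB.
pose w := [tuple (s i, i \in A) | i < n].
have wP : signed_perm w && avoiding w.
  apply/andP; split.
    apply/forallP => k; rewrite -map_comp.
    rewrite count_uniq_mem; last first.
      by rewrite map_inj_uniq ?enum_uniq //; apply: perm_inj.
    rewrite eqb1; apply/mapP.
    by exists ((s^-1)%g k); rewrite ?mem_enum //= permKV.
  apply/negP => /existsP[i /existsP[j]]; rewrite !tnth_mktuple /=.
  move=> /and3P[lt_ij /eqP eqA]; rewrite ltnNge => /negP[]; apply/ltnW.
  move: eqA; rewrite /barred /=; have [Ai Aj | nAi nAj] := boolP (i \in A).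
    exact: smA.
  by apply: smC; rewrite ?inE // -nAj.
pose b := MkPB wP; have DA : Des b = A.
  by apply/setP => i; rewrite mem_Des tnth_mktuple.
exists b; split=> //; rewrite /barred_symbols DA -sA.
by apply: eq_imset => i; rewrite tnth_mktuple.
Qed.

Lemma pb_ltE (b b' : PB n) : (b < b')%O = (Des b \proper Des b').
Proof. by []. Qed.

End SignedPermutations.

(** * Ranks and antichains *)

Section RankFunctions.
Variables (T : finType) (rk : T -> nat).

Lemma rank_size_bij (T' : finType) (rk' : T' -> nat) (f : T -> T') :
  bijective f -> (forall x, rk' (f x) = rk x) -> rank_size rk' =1 rank_size rk.
Proof.
move=> bij_f rk_f k; rewrite /rank_size -(card_imset _ (bij_inj bij_f)).
have [g fK gK] := bij_f; apply: eq_card => y; rewrite inE.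
apply/idP/imsetP => [rk_y | [x]]; last by rewrite inE -rk_f => rk_x ->.
by exists (g y); rewrite ?gK // inE -rk_f gK.
Qed.

Lemma rank_gf_bij (T' : finType) (rk' : T' -> nat) (f : T -> T') :
  bijective f -> (forall x, rk' (f x) = rk x) -> rank_gf rk' = rank_gf rk.
Proof.
move=> bij_f rk_f; have eq_top : top_rank rk' = top_rank rk.
  rewrite /top_rank (reindex f) /=; last exact: onW_bij.
  by apply: eq_bigr => x _; apply: rk_f.
rewrite /rank_gf eq_top; apply: eq_bigr => k _.
by rewrite (rank_size_bij bij_f rk_f).
Qed.

Lemma rank_le_top x : rk x <= top_rank rk.
Proof. exact: (@leq_bigmax _ rk). Qed.

Lemma card_ranks_in (l : seq nat) : uniq l ->
  #|[set x | rk x \in l]| = \sum_(k <- l) rank_size rk k.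
Proof.
elim: l => [_|k l IHl] /=.
  by rewrite big_nil; apply: eq_card0 => x; rewrite inE.
move=> /andP[kl ul]; rewrite big_cons -IHl // /rank_size -cardsUI.
rewrite -[LHS]addn0; congr addn.
  by apply: eq_card => x; rewrite !inE.
apply/esym/eq_card0 => x; rewrite !inE; apply: contraNF kl.
by case/andP => /eqP->.
Qed.

End RankFunctions.

(** Peel off heads: the head of a decreasing list bounds every entry of a sublist. *)
Lemma sumn_take_sorted (k : nat) (s t : seq nat) :
  sorted geq s -> subseq t s -> size t <= k -> sumn t <= sumn (take k s).
Proof.
elim: s k t => [|x s IHs] k t /=; first by move=> _ /eqP->.
case: k => [|k]; first by case: t.
case: t => [|y t] //= srt sub sz.
have [le_yx subts] : y <= x /\ subseq t s.
  move: sub; have [-> //| _] := eqVneq y x => sub; split.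
    have tr : transitive geq by move=> a b c /= ba ca; apply: leq_trans ca ba.
    apply: (allP (order_path_min tr srt)); apply: (mem_subseq sub).
    exact: mem_head.
  by apply: subseq_trans sub; apply: subseq_cons.
by rewrite leq_add // IHs // (path_sorted srt).
Qed.

Lemma sumn_take_sort (k : nat) (s t : seq nat) :
  subseq t s -> size t <= k -> sumn t <= sumn (take k (sort geq s)).
Proof.
have tot : total geq by move=> a b; apply: leq_total.
have tr : transitive geq by move=> a b c /= ba ca; apply: leq_trans ca ba.
move=> sub sz; have /perm_sumn <- : perm_eq (sort geq t) t by rewrite perm_sort.
by apply: sumn_take_sorted; rewrite ?size_sort ?sort_sorted ?subseq_sort.
Qed.

Lemma sum_largest_ranks_le_antichains d (T : finPOrderType d) (rk : T -> nat)
    (k : nat) :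
    (forall x y : T, (x < y)%O -> rk x < rk y) ->
  sum_largest_ranks rk k <= max_antichain_union T k.
Proof.
move=> rk_lt; pose r := top_rank rk.
(* Ranks listed by decreasing size: the [i]-th antichain is the [i]-th rank of this list, and it is
   empty once the list is exhausted. *)
pose s := sort (relpre (rank_size rk) geq) (iota 0 r.+1).
have us : uniq s by rewrite sort_uniq iota_uniq.
have rk_s x : rk x \in s by rewrite mem_sort mem_iota /= ltnS rank_le_top.
pose F := [ffun i : 'I_k => [set x | index (rk x) s == i]].
have FA : [forall i, antichain (F i)].
  apply/forallP => i; apply/forall_inP => x; rewrite ffunE inE => /eqP ix.
  apply/forall_inP => y; rewrite inE => /eqP iy; apply/negP => /rk_lt.
  by rewrite -(nth_index 0 (rk_s x)) ix -iy nth_index // ltnn.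
apply: leq_trans (leq_bigmax_cond (F := fun F : {ffun 'I_k -> {set T}} =>
  #|\bigcup_(i < k) F i|) F FA).
have -> : \bigcup_(i < k) F i = [set x | rk x \in take k s].
  apply/setP => x; rewrite inE in_take //; apply/bigcupP/idP => [[i _]|lt_k].
    by rewrite ffunE inE => /eqP->.
  by exists (Ordinal lt_k); rewrite // ffunE inE.
rewrite card_ranks_in ?take_uniq // /sum_largest_ranks /mkseq sort_map.
by rewrite -map_take sumnE big_map.
Qed.

(** * The descent poset: rank sizes, duality and the Sperner property *)

Section DescentPoset.
Variable n : nat.

Lemma pb_rank_le (b : PB n) : pb_rank b <= n.
Proof. by rewrite -[X in _ <= X](card_ord n) max_card. Qed.

Lemma pb_rank_lt (b b' : PB n) : (b < b')%O -> pb_rank b < pb_rank b'.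
Proof. exact: proper_card. Qed.

Lemma pb_top_rank : top_rank (@pb_rank n) = n.
Proof.
apply/eqP; rewrite eqn_leq; apply/andP; split.
  by apply/bigmax_leqP => b _; apply: pb_rank_le.
have [b [Db _]] := pb_realize (erefl #|[set: 'I_n]|).
by apply: leq_trans (rank_le_top _ b); rewrite /pb_rank Db cardsT card_ord.
Qed.

Lemma pb_rank_size k : rank_size (@pb_rank n) k = 'C(n, k) ^ 2.
Proof.
pose f (b : PB n) := (Des b, barred_symbols b).
have f_inj : injective f by move=> b b' [eqD eqS]; apply: pb_inj.
rewrite /rank_size -(card_imset _ f_inj).
pose D := [set A : {set 'I_n} | #|A| == k].
have -> : f @: [set b | pb_rank b == k] = setX D D.
  apply/setP => -[A B]; rewrite !inE /=.
  apply/imsetP/andP => [[b]|[/eqP cA /eqP cB]].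
    by rewrite inE => rk_b [-> ->]; rewrite card_barred_symbols.
  have [b [DA SB]] : exists b : PB n, Des b = A /\ barred_symbols b = B.
    by apply: pb_realize; rewrite cA cB.
  by exists b; rewrite ?inE /pb_rank /f DA ?cA ?SB.
by rewrite cardsX card_draws card_ord.
Qed.

Lemma pb_rank_symmetric : rank_symmetric (@pb_rank n).
Proof.
by move=> k; rewrite pb_top_rank => le_kn; rewrite !pb_rank_size bin_sub.
Qed.

Lemma pb_rank_unimodal : rank_unimodal (@pb_rank n).
Proof.
exists n./2; rewrite pb_top_rank; split=> [|k lt_k|k le_k lt_k].
- by lia.
(* Consecutive binomials have ratio [n - k] to [k.+1], so these two numbers are compared. *)
- rewrite !pb_rank_size leq_sqr -(leq_pmul2l (ltn0Sn k)) mul_bin_left.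
  by rewrite leq_mul2r; apply/orP; right; lia.
- rewrite !pb_rank_size leq_sqr -(leq_pmul2l (ltn0Sn k)) mul_bin_left.
  by rewrite leq_mul2r; apply/orP; right; lia.
Qed.

Lemma pb_complement (b : PB n) : exists b' : PB n,
  (Des b' == ~: Des b) && (barred_symbols b' == ~: barred_symbols b).
Proof.
have [|b' [eqD eqS]] := @pb_realize n (~: Des b) (~: barred_symbols b).
  by apply: eq_card_setC; rewrite card_barred_symbols.
by exists b'; rewrite eqD eqS !eqxx.
Qed.

(** Complementing both the descent set and the set of barred symbols is an order-reversing
    involution. *)
Lemma pb_self_dual : self_dual (PB n).
Proof.
pose f b := xchoose (pb_complement b).
have fD b : Des (f b) = ~: Des b.
  by have /andP[/eqP] := xchooseP (pb_complement b).
have fS b : barred_symbols (f b) = ~: barred_symbols b.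
  by have /andP[_ /eqP] := xchooseP (pb_complement b).
have fK : involutive f by move=> b; apply: pb_inj; rewrite ?fD ?fS setCK.
exists f; split; first exact: inv_bij.
move=> b b'; rewrite leEdual !le_eqVlt (inj_eq (inv_inj fK)) eq_sym !pb_ltE.
by rewrite !fD !properE !setCS.
Qed.

Definition low (r : nat) : {set 'I_n} := [set i : 'I_n | i < r].

Lemma card_low r : r <= n -> #|low r| = r.
Proof.
move=> le_rn; rewrite /low (card_ord_pred n (fun i => i < r)) -size_filter.
rewrite -[RHS](size_iota 0); congr size.
rewrite -{1}(subnKC le_rn) iotaD filter_cat.
rewrite (eq_in_filter (a2 := predT)) ?filter_predT; last first.
  by move=> i; rewrite mem_iota /=; lia.
rewrite (eq_in_filter (a2 := pred0)) ?filter_pred0 ?cats0 //.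
by move=> i; rewrite mem_iota /=; lia.
Qed.

Lemma low_proper r r' : r < r' -> r' <= n -> low r \proper low r'.
Proof.
move=> lt_r le_r'; rewrite properEcard !card_low ?lt_r ?andbT //; last by lia.
by apply/subsetP => i; rewrite !inE; lia.
Qed.

(* A pair of permutations carries the maximal chain of initial segments to
   another maximal chain of [PB n]; [hits g x] says that [x] lies on it. *)
Definition hits (g : {perm 'I_n} * {perm 'I_n}) (x : PB n) : bool :=
  (g.1 @: low (pb_rank x) == Des x) &&
  (g.2 @: low (pb_rank x) == barred_symbols x).

Lemma hits_uniq g x y : hits g x -> hits g y -> pb_rank x = pb_rank y -> x = y.
Proof.
move=> /andP[/eqP Dx /eqP Sx] /andP[/eqP Dy /eqP Sy] eq_r.
by apply: pb_inj; rewrite -?Dx -?Dy -?Sx -?Sy eq_r.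
Qed.

Lemma hits_lt g x y :
  hits g x -> hits g y -> pb_rank x < pb_rank y -> (x < y)%O.
Proof.
move=> /andP[/eqP Dx _] /andP[/eqP Dy _] lt_r.
rewrite pb_ltE -Dx -Dy properEcard imsetS ?(card_imset _ perm_inj) /=.
  by apply: proper_card; rewrite low_proper ?pb_rank_le.
by apply: proper_sub; rewrite low_proper ?pb_rank_le.
Qed.

Lemma hits_exists g r : r <= n -> exists x, (pb_rank x == r) && hits g x.
Proof.
move=> le_rn; have eqc : #|g.1 @: low r| = #|g.2 @: low r|.
  by rewrite !(card_imset _ perm_inj).
have [x [Dx Sx]] := pb_realize eqc.
have rx : pb_rank x = r by rewrite /pb_rank Dx (card_imset _ perm_inj) card_low.
by exists x; rewrite /hits rx Dx Sx !eqxx.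
Qed.

(** Composing with permutations that carry the two sets of [x] to those of [y] is injective on pairs
    and turns chains through [x] into chains through [y]. *)
Lemma sum_hits_const x y : pb_rank x = pb_rank y ->
  \sum_g (hits g x : nat) = \sum_g (hits g y : nat).
Proof.
move=> eq_r; have [u [uD _ _]] := perm_matching (eq_r : #|Des x| = #|Des y|).
have [|v [vS _ _]] := @perm_matching n (barred_symbols x) (barred_symbols y).
  by rewrite !card_barred_symbols.
have mul_inj : injective
    (fun g : {perm 'I_n} * {perm 'I_n} => (g.1 * u, g.2 * v)%g).
  by move=> [g1 g2] [h1 h2] [/mulIg-> /mulIg->].
rewrite [RHS](reindex_inj mul_inj); apply: eq_bigr => g _; congr nat_of_bool.
have im (p q : {perm 'I_n}) (A : {set 'I_n}) : (p * q)%g @: A = q @: (p @: A).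
  by rewrite -imset_comp; apply: eq_imset => i; rewrite permM.
by rewrite /hits /= !im -uD -vS -eq_r !(inj_eq (imset_inj perm_inj)).
Qed.

(** Each chain meets each rank in exactly one element, and elements of one rank are met equally
    often. *)
Lemma rank_size_mul_sum_hits x :
  rank_size (@pb_rank n) (pb_rank x) * \sum_g (hits g x : nat) =
    #|{: {perm 'I_n} * {perm 'I_n}}|.
Proof.
rewrite -sum1_card /rank_size -sum_nat_const.
rewrite (eq_bigr (fun y => \sum_g (hits g y : nat))); last first.
  by move=> y; rewrite inE => /eqP eq_r; apply/esym/sum_hits_const.
rewrite exchange_big; apply: eq_bigr => g _.
have [y /andP[ry hy]] := hits_exists g (pb_rank_le x).
rewrite (bigD1 y) ?inE //= hy big1 ?addn0 // => z.
rewrite inE => /andP[rz ne_zy].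
apply/eqP; rewrite eqb0; apply: contra ne_zy => hz; apply/eqP.
by apply: (hits_uniq hz hy); rewrite (eqP rz) (eqP ry).
Qed.

(** Distinct elements of a chain are comparable, so choosing for each an antichain that contains it
    is injective. *)
Lemma hits_antichains k (F : {ffun 'I_k -> {set PB n}}) g : 0 < k ->
    (forall i, antichain (F i)) ->
  #|[set x in \bigcup_(i < k) F i | hits g x]| <= k.
Proof.
move=> k_gt0 FA; pose f x := odflt (Ordinal k_gt0) [pick i | x \in F i].
have fP x : x \in \bigcup_(i < k) F i -> x \in F (f x).
  case/bigcupP => i _ Fix; rewrite /f; case: pickP => [//|/(_ i)].
  by rewrite Fix.
rewrite -(card_in_imset (f := f)).
  by rewrite -[X in _ <= X]card_ord max_card.
have nlt x y : x \in F (f x) -> y \in F (f x) -> ~~ (x < y)%O.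
  by move=> Fx Fy; have /forall_inP/(_ x Fx)/forall_inP/(_ y Fy) := FA (f x).
move=> x y; rewrite !inE => /andP[/fP Fx hx] /andP[/fP Fy hy] eq_f.
have [lt | lt | eq_r] := ltngtP (pb_rank x) (pb_rank y).
- by have := nlt x y Fx; rewrite eq_f Fy (hits_lt hx hy lt) => /(_ isT).
- by have := nlt y x Fy; rewrite -eq_f Fx (hits_lt hy hx lt) => /(_ isT).
- exact: hits_uniq hx hy eq_r.
Qed.

Lemma sum_hits_le k (X : {set PB n}) g : #|[set x in X | hits g x]| <= k ->
  \sum_(x in X | hits g x) rank_size (@pb_rank n) (pb_rank x) <=
    sum_largest_ranks (@pb_rank n) k.
Proof.
set w := rank_size _; set Y := [set x in X | hits g x] => cY.
have -> : \sum_(x in X | hits g x) w (pb_rank x) = \sum_(x in Y) w (pb_rank x).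
  by apply: eq_bigl => x; rewrite inE.
pose l := [seq pb_rank x | x in Y].
have ul : uniq l.
  rewrite map_inj_in_uniq ?enum_uniq // => x y; rewrite !mem_enum !inE.
  by case/andP => _ hx /andP[_ hy]; apply: hits_uniq hx hy.
(* Reordered as a sublist of all ranks, [l] fits the sublist hypothesis of [sumn_take_sort]. *)
have pl : perm_eq l [seq r <- iota 0 n.+1 | r \in l].
  apply: uniq_perm; rewrite ?filter_uniq ?iota_uniq // => r.
  rewrite mem_filter mem_iota /= add0n ltnS andb_idr //.
  by case/mapP => x _ ->; apply: pb_rank_le.
have -> : \sum_(x in Y) w (pb_rank x) =
    sumn (map w [seq r <- iota 0 n.+1 | r \in l]).
  by rewrite -(perm_sumn (perm_map w pl)) sumnE !big_map big_enum.
rewrite /sum_largest_ranks pb_top_rank; apply: sumn_take_sort.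
  by apply: map_subseq; apply: filter_subseq.
by rewrite size_map -(perm_size pl) size_map -cardE.
Qed.

(** Multiply the size of the union by the number of chains, write that number for each [x] as its
    rank size times the number of chains through [x], and sum over chains first: each chain
    contributes at most the [k] largest rank sizes. *)
Lemma pb_strongly_sperner : strongly_sperner (@pb_rank n).
Proof.
move=> k k_gt0; apply/eqP; rewrite eqn_leq andbC.
rewrite sum_largest_ranks_le_antichains; last exact: pb_rank_lt.
apply/bigmax_leqP => F /forallP FA; set X := \bigcup_(i < k) F i.
have G_gt0 : 0 < #|{: {perm 'I_n} * {perm 'I_n}}|.
  by apply/card_gt0P; exists (1, 1)%g.
rewrite -(leq_pmul2r G_gt0) -sum_nat_const.
rewrite -(eq_bigr _ (fun x _ => rank_size_mul_sum_hits x)).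
rewrite (eq_bigr
    (fun x => \sum_g rank_size (@pb_rank n) (pb_rank x) * hits g x));
  last by move=> x _; rewrite big_distrr.
rewrite exchange_big mulnC -sum_nat_const; apply: leq_sum => g _.
apply: leq_trans (sum_hits_le (hits_antichains g k_gt0 FA)).
rewrite big_mkcondr; apply: leq_sum => x _.
by case: (hits g x); rewrite ?muln1 ?muln0.
Qed.

End DescentPoset.

(** * The order extension *)

Section Extension.
Variable n : nat.
Hypothesis n_gt0 : 0 < n.

Lemma ncb_image_exists (pi : NCB n) : exists b : PB n,
  (Des b == ~: openers n_gt0 pi) && (barred_symbols b == ~: closers n_gt0 pi).
Proof.
have [|b [eqD eqS]] :=
  @pb_realize n (~: openers n_gt0 pi) (~: closers n_gt0 pi).
  exact/eq_card_setC/card_openers.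
by exists b; rewrite eqD eqS !eqxx.
Qed.

Definition ncb_pb (pi : NCB n) : PB n := xchoose (ncb_image_exists pi).

Lemma Des_ncb_pb pi : Des (ncb_pb pi) = ~: openers n_gt0 pi.
Proof. by have /andP[/eqP] := xchooseP (ncb_image_exists pi). Qed.

Lemma barred_symbols_ncb_pb pi :
  barred_symbols (ncb_pb pi) = ~: closers n_gt0 pi.
Proof. by have /andP[_ /eqP] := xchooseP (ncb_image_exists pi). Qed.

Lemma ncb_pb_inj : injective ncb_pb.
Proof.
move=> pi pi' eq_b; apply: (openers_closers_inj (n_gt0 := n_gt0));
  apply: setC_inj; first by rewrite -!Des_ncb_pb eq_b.
by rewrite -!barred_symbols_ncb_pb eq_b.
Qed.

Lemma ncb_pb_bij : bijective ncb_pb.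
Proof.
apply: (inj_card_bij ncb_pb_inj).
have ex (b : PB n) : exists pi, ncb_pb pi == b.
  have [|pi [eqO eqC]] := @ncb_realize n n_gt0 (~: Des b) (~: barred_symbols b).
    by apply: eq_card_setC; rewrite card_barred_symbols.
  exists pi; apply/eqP/pb_inj.
    by rewrite Des_ncb_pb eqO setCK.
  by rewrite barred_symbols_ncb_pb eqC setCK.
(* Choosing preimages is injective, which gives the cardinal inequality that makes [ncb_pb]
   bijective. *)
apply: (leq_card (fun b => xchoose (ex b))) => b b' eq_pi.
by rewrite -(eqP (xchooseP (ex b))) eq_pi (eqP (xchooseP (ex b'))).
Qed.

Lemma ncb_pb_lt pi pi' : (pi < pi')%O -> (ncb_pb pi < ncb_pb pi')%O.
Proof.
move=> /(openers_proper n_gt0); rewrite pb_ltE !Des_ncb_pb !properE !setCS.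
by [].
Qed.

Lemma ncb_pb_rank pi : pb_rank (ncb_pb pi) = ncb_rank pi.
Proof.
by rewrite (ncb_rankE n_gt0) /pb_rank Des_ncb_pb cardsCs setCK card_ord.
Qed.

End Extension.

Theorem theorem3 (n : nat) (hn : (1 <= n)%N) :
  (exists phi : NCB n -> PB n,
     bijective phi /\
     (forall pi pi' : NCB n, (pi < pi')%O -> (phi pi < phi pi')%O)) /\
  rank_gf (@pb_rank n) = rank_gf (@ncb_rank n) /\
  rank_symmetric (@pb_rank n) /\
  rank_unimodal (@pb_rank n) /\
  self_dual (PB n) /\
  strongly_sperner (@pb_rank n).
Proof.
split.
  by exists (ncb_pb hn); split; [apply: ncb_pb_bij | apply: ncb_pb_lt].
split; first exact: rank_gf_bij (ncb_pb_bij hn) (ncb_pb_rank hn).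
split; first exact: pb_rank_symmetric.
split; first exact: pb_rank_unimodal.
by split; [apply: pb_self_dual | apply: pb_strongly_sperner].
Qed.
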